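(* Let $$\Xi_G := \Bigl\{ x = \sum_{k=1}^\infty x_k 2^{-k} :\ x_k \in \{0,1\},\ x_k x_{2k} = 0 \ \text{for all } k \ge 1 \Bigr\} \subset [0,1].$$ Then $\dim_H(\Xi_G) < \dim_M(\Xi_G)$. In fact, $$\dim_H(\Xi_G) = -\log_2 p = 0.81137\ldots,$$ where $p$ is the real number with $0<p<1$ and $p^3 = (1-p)^2$.
   Context: $\dim_H$ denotes Hausdorff dimension and $\dim_M$ denotes Minkowski (box-counting) dimension of subsets of $\mathbb{R}$ with the usual metric. It is known (Fan, Liao, Ma) that the Minkowski dimension of $\Xi_G$ exists and equals $\sum_{k=1}^\infty 2^{-k-1}\log_2 F_{k+1} = 0.82429\ldots$, where $F_1 = 1$, $F_2 = 2$, $F_{k+1} = F_{k-1}+F_k$. *)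

(* Defs.v *)
From HB Require Import structures.
From mathcomp Require Import all_boot all_order all_algebra.
From mathcomp Require Import all_classical all_reals all_analysis.

Set Implicit Arguments.
Unset Strict Implicit.
Unset Printing Implicit Defensive.

Import Order.TTheory GRing.Theory Num.Theory.
Import numFieldNormedType.Exports.

Local Open Scope classical_set_scope.
Local Open Scope ring_scope.

(* The value a 0 is not used: digits are numbered from 1. *)
Definition Xi_G (R : realType) : set R :=
  [set x | exists a : nat -> bool,
     (forall k, (0 < k)%N -> (a k * a (2 * k) = 0)%N) /\
     \sum_(1 <= k < n) (a k)%:R / 2 ^+ k @[n --> \oo] --> x].

Section HausdorffDimension.
Variable R : realType.
Implicit Types (A U : set R) (s d : R).
Local Open Scope ereal_scope.

Definition diam U : \bar R :=
  ereal_sup [set `|z.1 - z.2|%:E | z in U `*` U].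

(* diam(U)^s, with the empty set counting for 0 (so that the covers below
   may be finite) and diam(U)^0 = 1 for U nonempty. *)
Definition diam_pow s U : \bar R :=
  if `[< U = set0 >] then 0 else diam U `^ s.

Definition hausdorff_premeasure s d A : \bar R :=
  ereal_inf [set \sum_(0 <= i <oo) diam_pow s (U i) | U in
    [set U : nat -> set R |
       (forall i, diam (U i) <= d%:E) /\ A `<=` \bigcup_i U i]].

Definition hausdorff_measure s A : \bar R :=
  ereal_sup [set hausdorff_premeasure s d A | d in [set d | (0 < d)%R]].

Definition hausdorff_dim A : \bar R :=
  ereal_inf [set s%:E | s in [set s | (0 <= s)%R /\ hausdorff_measure s A = 0]].

End HausdorffDimension.

Section MinkowskiDimension.
Variable R : realType.
Implicit Types (A : set R) (r : R) (m : \bar R).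
Local Open Scope ereal_scope.

(* The least number of closed balls of radius r covering A
   (+oo if there is no finite cover). *)
Definition covering_number A r : \bar R :=
  ereal_inf [set (n%:R)%:E | n in
    [set n | exists c : 'I_n -> R,
       A `<=` \bigcup_i closed_ball (c i) r]].

Definition has_minkowski_dim A m :=
  lne (covering_number A r) / (ln r^-1)%:E @[r --> 0^'+] --> m.

End MinkowskiDimension.

Definition log2 (R : realType) (x : R) : R := ln x / ln 2.

(* Main.v *)
Require Import Defs.
From mathcomp Require Import all_boot all_order all_algebra.
From mathcomp Require Import all_classical all_reals all_analysis.
From mathcomp Require Import zify ring lra.
Import Order.TTheory GRing.Theory Num.Theory.
Import numFieldNormedType.Exports.
Local Open Scope classical_set_scope.
Local Open Scope ring_scope.

Set Implicit Arguments.
Unset Strict Implicit.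
Unset Printing Implicit Defensive.

(** Along each chain [i, 2i, 4i, ...] with [i] odd, the digits of a point of
    [Xi_G] form a 0-1 sequence without two consecutive ones, and different
    chains do not interact.  Everything below exploits this product structure.

    Hausdorff dimension.  Put [r = sqrt p], so that [p = r^2], [1 - p = r^3] and
    [r^2 + r^3 = 1].  Run on every chain the Markov chain that draws 1 with
    probability [1 - p] unless the previous digit was 1, in which case it must
    draw 0.  A digit that is free contributes [r^2] or [r^3] to the mass, and a
    forced one contributes 1.  If [N n] is the number of ones among the first
    [n] digits, then [N (n/2)] of these digits are forced, and the mass of the
    cylinder of length [n] is [r^(2n + N n - 2 N (n/2))] (lemma [mu_initial]).
    Hence the local dimension at a point is [- log2 p] exactly when the balance
    [N n / 2 - N (n/2)] is [o(n)].

    - Upper bound.  The averages [N n / n] satisfy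
      [N n / n - N (n/2) / (n/2) = 2 balance / n] for even [n]; along
      [n = m, 2m, 4m, ...] these differences telescope, so for every point they
      cannot stay above a positive constant ([balance_frequently_le]).  Each
      point thus lies in arbitrarily short cylinders [w] with
      [mu w >= |w|^t], [t > - log2 p], and such cylinders give efficient covers.
    - Lower bound.  [N n - (1 - p) (n - N (n/2))] is a martingale with bounded
      increments, so it exceeds [e n] only with exponentially small mass
      ([drift_tail]).  Whenever it is [o(n)], the average [f n = N n / n] obeys
      [f n = (1 - p) (1 - f (n/2) / 2) + o(1)], a contraction, so [f]
      converges and the balance is [o(n)] ([balance_ge]).  So most of the mass
      lies on cylinders with [mu w <= |w|^t], [t < - log2 p], and the mass
      distribution principle applies.  No measure on the space of sequences is
      constructed: [avoid_words] extracts directly, digit by digit, a sequence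
      that avoids a family of words of total mass less than 1.

    Minkowski dimension.  The admissible words of length [n] are counted exactly:
    their number is the product, over the chains, of the Fibonacci number that
    counts the words along that chain ([count_admissibleE]).  Its logarithm is
    [n Lam + o(n)], where [Lam] is the sum over [j] of
    [2^(-j-1) ln (fibo (j+2) / fibo (j+1))].  Six terms of this series already
    exceed [52/64 ln 2], whereas [- log2 p < 0.81138 < 52/64]. *)

(** * Binary words *)

Section Words.
Local Open Scope nat_scope.
Implicit Types (u w : seq bool) (a : nat -> bool).

Definition initial a n := mkseq (fun i => a i.+1) n.

(** Digits are numbered from 1; the dummy entry in front and the default value
    make digit 0 and all digits beyond the word equal to 0. *)
Definition digit u k := nth false (false :: u) k.

(** The digit that follows [u] has index [size u + 1 = 2j]; it has to be 0 when
    digit [j] is 1. *)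
Definition forced u := odd (size u) && digit u (size u).+1./2.

Definition admissible u :=
  all (fun k => ~~ (nth false u k && forced (take k u))) (iota 0 (size u)).

(** The words of length [n] are numbered by their binary value, so that sums over
    words are sums over an interval of integers. *)
Fixpoint word n N := if n is n'.+1 then rcons (word n' N./2) (odd N) else [::].

Definition binval u := foldl (fun x (b : bool) => x.*2 + b) 0 u.

Lemma size_initial a n : size (initial a n) = n.
Proof. exact: size_mkseq. Qed.

Lemma initialS a n : initial a n.+1 = rcons (initial a n) (a n.+1).
Proof. by rewrite /initial mkseqS. Qed.

Lemma admissible_rcons u b : admissible (rcons u b) = admissible u && ~~ (b && forced u).
Proof.
rewrite /admissible size_rcons -addn1 iotaD all_cat /= andbT add0n.
rewrite nth_rcons ltnn eqxx -cats1 take_size_cat //; congr (_ && _).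
apply: eq_in_all => k; rewrite mem_iota add0n => /= lt_ku.
by rewrite nth_cat lt_ku take_cat lt_ku.
Qed.

Lemma admissible_cat u w : admissible (u ++ w) -> admissible u.
Proof.
elim/last_ind: w => [|w b IH]; first by rewrite cats0.
by rewrite -rcons_cat admissible_rcons => /andP[/IH].
Qed.

Lemma digit_initial a n k : 0 < k <= n -> digit (initial a n) k = a k.
Proof. by case: k => // k /andP[_ le_kn]; rewrite /digit /= nth_mkseq. Qed.

Lemma forced_initial a n : forced (initial a n) = odd n && a n.+1./2.
Proof.
rewrite /forced size_initial; case: (boolP (odd n)) => //= odd_n.
by rewrite digit_initial //; lia.
Qed.

Lemma admissible_initial a n :
  (forall k, 0 < k -> ~~ (a k && a k.*2)) -> admissible (initial a n).
Proof.
move=> Ha; elim: n => [//|n IH]; rewrite initialS admissible_rcons IH /= forced_initial.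
case: (boolP (odd n)) => [odd_n|]; last by rewrite andbF.
have k_gt0 : 0 < n.+1./2 by lia.
have := Ha _ k_gt0; have -> : n.+1./2.*2 = n.+1 by lia.
by rewrite andbC.
Qed.

Lemma initial_admissible a : (forall n, admissible (initial a n)) ->
  forall k, 0 < k -> ~~ (a k && a k.*2).
Proof.
move=> Ha k k_gt0; have := Ha k.*2.-1.+1.
rewrite initialS admissible_rcons forced_initial => /andP[_].
have -> : k.*2.-1.+1 = k.*2 by lia.
have -> : odd k.*2.-1 by lia.
have -> : k.*2./2 = k by lia.
by rewrite andbC.
Qed.

Lemma initial_digit u : initial (digit u) (size u) = u.
Proof. exact: mkseq_nth. Qed.

Lemma initial_digit_add u m : initial (digit u) (size u + m) = u ++ nseq m false.
Proof.
elim: m => [|m IH]; first by rewrite addn0 initial_digit cats0.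
rewrite addnS initialS IH /digit /= nth_default ?leq_addr // -cats1 -catA cats1.
by congr (_ ++ _); elim: m {IH} => //= m ->.
Qed.

Lemma take_initial a m n : m <= n -> take m (initial a n) = initial a m.
Proof. by move=> le_mn; rewrite /initial /mkseq -map_take take_iota (minn_idPl _). Qed.

Lemma admissible_digit u n : admissible u -> admissible (initial (digit u) n).
Proof.
move=> admissible_u.
have H m : admissible (u ++ nseq m false).
  elim: m => [|m IH]; first by rewrite cats0.
  rewrite (_ : u ++ nseq m.+1 false = rcons (u ++ nseq m false) false).
    by rewrite admissible_rcons IH.
  by rewrite rcons_cat; congr (_ ++ _); elim: m {IH} => //= m ->.
apply: (@admissible_cat _ (drop n (initial (digit u) (size u + n)))).
by rewrite -{1}(@take_initial (digit u) n (size u + n)) ?leq_addl //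
  cat_take_drop initial_digit_add.
Qed.

Lemma size_word n N : size (word n N) = n.
Proof. by elim: n N => //= n IH N; rewrite size_rcons IH. Qed.

Lemma binval_rcons u b : binval (rcons u b) = (binval u).*2 + b.
Proof. by rewrite /binval foldl_rcons. Qed.

Lemma word_binval u : word (size u) (binval u) = u.
Proof.
elim/last_ind: u => //= u b IH; rewrite size_rcons /= binval_rcons.
have -> : ((binval u).*2 + b)./2 = binval u by case: b; lia.
by rewrite oddD odd_double oddb IH.
Qed.

Lemma binval_word n N : N < 2 ^ n -> binval (word n N) = N.
Proof.
elim: n N => [|n IH] N; first by case: N.
rewrite expnS /= => lt_N; rewrite binval_rcons IH; lia.
Qed.

Lemma binval_lt u : binval u < 2 ^ size u.
Proof.
elim/last_ind: u => //= u b IH; rewrite size_rcons binval_rcons expnS.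
by case: b; lia.
Qed.

(** An initial word of length [m + n] extends the one of length [m] by [n] binary
    digits. *)
Lemma initial_binval_bounds a m n :
  binval (initial a m) * 2 ^ n <= binval (initial a (m + n))
    < (binval (initial a m)).+1 * 2 ^ n.
Proof.
elim: n => [|n]; first by rewrite addn0 expn0 !muln1 leqnn ltnS leqnn.
rewrite addnS initialS binval_rcons expnS; case: (a _); nia.
Qed.

End Words.

(** * Mass functions on words *)

Definition words n := [seq word n N | N <- iota 0 (2 ^ n)].

Lemma mem_words n w : (w \in words n) = (size w == n).
Proof.
apply/mapP/eqP => [[N _ ->]|<-]; first exact: size_word.
by exists (binval w); rewrite ?word_binval // mem_iota add0n binval_lt.
Qed.

Lemma sum_nat_double (V : nmodType) (f : nat -> V) m :
  \sum_(0 <= i < m.*2) f i = \sum_(0 <= i < m) (f i.*2 + f i.*2.+1).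
Proof.
elim: m => [|m IH]; first by rewrite !big_geq.
by rewrite doubleS !big_nat_recr //= IH addrA.
Qed.

Lemma sum_words_nat (V : nmodType) (F : seq bool -> V) n :
  \sum_(w <- words n) F w = \sum_(0 <= N < 2 ^ n) F (word n N).
Proof. by rewrite big_map /index_iota subn0. Qed.

Lemma sum_wordsS (V : nmodType) (F : seq bool -> V) n :
  \sum_(w <- words n.+1) F w =
  \sum_(w <- words n) (F (rcons w false) + F (rcons w true)).
Proof.
rewrite !sum_words_nat expnS mul2n sum_nat_double.
apply: eq_bigr => N _ /=.
by rewrite odd_double uphalf_double doubleK.
Qed.

Lemma sum_words_additive (V : nmodType) (F : seq bool -> V) n :
  (forall u, (size u < n)%N -> F u = F (rcons u false) + F (rcons u true)) ->
  \sum_(w <- words n) F w = F [::].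
Proof.
elim: n => [|n IH] HF; first by rewrite big_seq1.
rewrite sum_wordsS -IH => [|u lt_un]; last by rewrite HF // ltnW.
rewrite !big_seq; apply: eq_bigr => w.
by rewrite mem_words => /eqP size_w; rewrite -HF // size_w.
Qed.

Section Mass.
Variable R : realType.
Implicit Types (W : seq bool -> R) (c : seq bool -> bool -> R) (u w : seq bool).

(** A probability measure on infinite binary sequences, given by its values on
    cylinders. *)
Definition mass_function W :=
  [/\ W [::] = 1, forall u, 0 <= W u
    & forall u, W u = W (rcons u false) + W (rcons u true)].

Definition weight c u := \prod_(k < size u) c (take k u) (nth false u k).

Lemma weight_rcons c u b : weight c (rcons u b) = weight c u * c u b.
Proof.
rewrite /weight size_rcons big_ord_recr /= nth_rcons ltnn eqxx.
rewrite -cats1 take_size_cat //; congr (_ * _).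
by apply: eq_bigr => k _; rewrite nth_cat take_cat !ltn_ord.
Qed.

Lemma weight_mass c : (forall u b, 0 <= c u b) ->
  (forall u, c u false + c u true = 1) -> mass_function (weight c).
Proof.
move=> c_ge0 c_sum1; split; first by rewrite /weight big_ord0.
  by move=> u; apply: prodr_ge0.
by move=> u; rewrite !weight_rcons -mulrDr c_sum1 mulr1.
Qed.

Lemma sum_mass W n : mass_function W -> \sum_(w <- words n) W w = 1.
Proof. by case=> W0 _ Wadd; rewrite sum_words_additive. Qed.

(** The mass of the intersection of the cylinders of [u] and of [w]. *)
Definition cyl_mass W w u :=
  if prefix w u then W u else if prefix u w then W w else 0.

Lemma cyl_mass_nil W w : mass_function W -> cyl_mass W w [::] = W w.
Proof. by case=> W0 _ _; rewrite /cyl_mass prefix0s prefixs0; case: eqP => // ->. Qed.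

Lemma prefix_of_rcons (u w : seq bool) b :
  prefix w (rcons u b) = prefix w u || (w == rcons u b).
Proof.
case: (leqP (size w) (size u)) => Hwu.
  rewrite !prefixE -cats1 takel_cat // -prefixE.
  case: eqP => [Hw|]; last by rewrite orbF.
  by move: Hwu; rewrite Hw size_cat addn1 ltnn.
rewrite !prefixE take_oversize ?size_rcons // (take_oversize (ltnW Hwu)) eq_sym.
by case: (u =P w) => // Huw; move: Hwu; rewrite Huw ltnn.
Qed.

Lemma cyl_massE W w u : mass_function W ->
  cyl_mass W w u = cyl_mass W w (rcons u false) + cyl_mass W w (rcons u true).
Proof.
case=> _ _ Wadd; rewrite {1}/cyl_mass.
have [wu|not_wu] := boolP (prefix w u).
  by rewrite /cyl_mass !prefix_of_rcons wu.
have cyl_rcons b :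
    cyl_mass W w (rcons u b) = if prefix (rcons u b) w then W w else 0.
  rewrite /cyl_mass prefix_of_rcons (negPf not_wu) /=.
  by case: eqP => [->|//]; rewrite prefix_refl.
rewrite !cyl_rcons; have [/prefixP[v def_w]|not_uw] := boolP (prefix u w).
  case: v def_w => [def_w|x v def_w].
    by move: not_wu; rewrite def_w cats0 prefix_refl.
  have pre_x b : prefix (rcons u b) w = (b == x).
    by rewrite def_w -cats1 prefix_catr // eqxx prefix_cons prefix0s andbT.
  by rewrite !pre_x; case: x {def_w pre_x}; rewrite /= ?addr0 ?add0r.
have pre_false b : prefix (rcons u b) w = false.
  by apply: contraNF not_uw; apply: prefix_trans; apply: prefix_rcons.
by rewrite !pre_false addr0.
Qed.

(** This replaces both the extension of [W] to a measure and the compactness of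
    the space of sequences.  The total mass [F u] of the cylinders of the forbidden
    words inside the cylinder of [u] is additive in [u], as [W] is.  If [F u < W u]
    then the same strict inequality holds for one of the two children of [u], so
    starting from [F < 1 = W] at the empty word one can descend forever.  The
    inequality fails at a forbidden word. *)
Lemma avoid_words W (ws : nat -> seq (seq bool)) (q : R) : mass_function W ->
  (forall M, \sum_(0 <= i < M) \sum_(w <- ws i) W w <= q) -> q < 1 ->
  exists a, (forall n, 0 < W (initial a n)) /\ forall i n, initial a n \notin ws i.
Proof.
move=> W_mass sum_ws q_lt1; have [W_nil W_ge0 W_add] := W_mass.
pose F M u := \sum_(0 <= i < M) \sum_(w <- ws i) cyl_mass W w u.
have cyl_ge0 w u : 0 <= cyl_mass W w u by rewrite /cyl_mass; case: ifP => _ //; case: ifP.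
have F_mono u M1 M2 : (M1 <= M2)%N -> F M1 u <= F M2 u.
  move=> le_M; rewrite /F [leRHS](big_cat_nat (n := M1)) //= lerDl.
  by apply: sumr_ge0 => i _; apply: sumr_ge0.
have F_add u M : F M u = F M (rcons u false) + F M (rcons u true).
  rewrite /F -big_split; apply: eq_bigr => i _ /=.
  by rewrite -big_split; apply: eq_bigr => w _; apply: cyl_massE.
pose good u := exists2 q, q < W u & forall M, F M u <= q.
(* If both children failed, the sums [F M] at the two children would together
   exceed [q']. *)
have good_step u : exists b, good u -> good (rcons u b).
  apply: contrapT => no_b.
  have [q' q'_lt F_le] : good u.
    by apply: contrapT => not_good; apply: no_b; exists true => /not_good.
  pose e := (W u - q') / 2.
  have exceed b : exists M, W (rcons u b) - e < F M (rcons u b).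
    apply: contrapT => no_M; apply: no_b; exists b => _.
    exists (W (rcons u b) - e); first by rewrite ltrBlDr ltrDl divr_gt0 ?subr_gt0.
    by move=> M; rewrite leNgt; apply/negP => lt_F; apply: no_M; exists M.
  have [M0 F0] := exceed false; have [M1 F1] := exceed true.
  have := F_le (maxn M0 M1); rewrite F_add.
  have := F_mono (rcons u false) _ _ (leq_maxl M0 M1).
  have := F_mono (rcons u true) _ _ (leq_maxr M0 M1).
  have := W_add u; rewrite /e in F0 F1; lra.
have [f good_f] := choice good_step.
pose path_ n := iter n (fun u => rcons u (f u)) [::].
have good_path n : good (path_ n).
  elim: n => [|n IH]; last exact: good_f.
  exists q; rewrite ?W_nil // => M; rewrite /F.
  under eq_bigr do under eq_bigr do rewrite cyl_mass_nil //.
  exact: sum_ws.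
exists (fun k => last false (path_ k)).
have pre_path n : initial (fun k => last false (path_ k)) n = path_ n.
  by elim: n => [//|n IH]; rewrite initialS IH /= last_rcons.
split=> [n|i n]; rewrite pre_path; have [q' q'_lt F_le] := good_path n.
  by apply: le_lt_trans q'_lt; have := F_le 0; rewrite /F big_geq.
apply/negP => in_ws; move: q'_lt; apply/negP; rewrite -leNgt.
apply: le_trans (F_le i.+1); rewrite /F big_nat_recr //=.
rewrite (big_rem _ in_ws) /= {2}/cyl_mass prefix_refl addrCA lerDl.
rewrite addr_ge0 //; apply: sumr_ge0 => // j _; exact: sumr_ge0.
Qed.

End Mass.

(** * The Markov measure on golden sequences *)

Definition ones (a : nat -> bool) n : nat := (\sum_(1 <= k < n.+1) a k)%N.

Definition golden (a : nat -> bool) := forall k, (0 < k)%N -> ~~ (a k && a k.*2).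

Lemma onesS a n : ones a n.+1 = (ones a n + a n.+1)%N.
Proof. by rewrite /ones big_nat_recr. Qed.

Lemma ones_le a n : (ones a n <= n)%N.
Proof. by elim: n => [|n IH]; [rewrite /ones big_geq|rewrite onesS; case: (a _); lia]. Qed.

Section GoldenMeasure.
Variables (R : realType) (r : R).
Hypotheses (r_gt0 : 0 < r) (r_root : r ^+ 2 + r ^+ 3 = 1).
Implicit Types (u w : seq bool) (a : nat -> bool).

Lemma root_lt1 : r < 1.
Proof.
rewrite ltNge; apply/negP => r_ge1.
have := r_root; have := exprn_ege1 2 r_ge1; have := exprn_ege1 3 r_ge1; lra.
Qed.

Lemma root_cube_lt_half : r ^+ 3 < 1 / 2.
Proof.
suff : r ^+ 3 < r ^+ 2 by have := r_root; lra.
by rewrite exprS gtr_pMl ?exprn_gt0 // root_lt1.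
Qed.

Definition transition u (b : bool) : R :=
  if forced u then (~~ b)%:R else if b then r ^+ 3 else r ^+ 2.

Definition mu := weight transition.

Lemma transition_ge0 u b : 0 <= transition u b.
Proof.
by rewrite /transition; case: ifP => // _; case: ifP => _; rewrite exprn_ge0 // ltW. Qed.

Lemma transition_sum1 u : transition u false + transition u true = 1.
Proof. by rewrite /transition; case: ifP => //= _; rewrite addr0. Qed.

Lemma mu_mass : mass_function mu.
Proof. exact: weight_mass transition_ge0 transition_sum1. Qed.

Lemma mu_gt0_admissible u : 0 < mu u -> admissible u.
Proof.
elim/last_ind: u => // u b IH; rewrite /mu weight_rcons -/(mu u) admissible_rcons => mu_gt0.
have [_ mu_ge0 _] := mu_mass.
rewrite IH /=; last first.
  by rewrite lt0r mu_ge0 andbT; apply: contraTneq mu_gt0 => ->; rewrite mul0r ltxx.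
apply: contraTN mu_gt0 => /andP[-> u_forced].
by rewrite /transition u_forced mulr0 ltxx.
Qed.

Lemma ones_half a n :
  ones a n.+1./2 = (ones a n./2 + (odd n && a n.+1./2))%N.
Proof.
case: (boolP (odd n)) => odd_n; rewrite ?andTb ?andFb.
  have -> : n.+1./2 = n./2.+1 by lia.
  by rewrite onesS.
have -> : n.+1./2 = n./2 by lia.
by rewrite addn0.
Qed.

(** The exponent of [r] is kept nonnegative by moving the contribution of the
    forced digits to the left. *)
Lemma mu_initial a n : golden a ->
  mu (initial a n) * r ^+ (2 * ones a n./2) = r ^+ (2 * n + ones a n).
Proof.
move=> Ha; elim: n => [|n IH]; first by rewrite /mu /weight big_ord0 mul1r /ones !big_geq.
rewrite initialS /mu weight_rcons -/(mu _) ones_half onesS.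
have -> : (2 * (ones a n./2 + (odd n && a n.+1./2)) =
  2 * ones a n./2 + 2 * (odd n && a n.+1./2))%N by rewrite mulnDr.
rewrite exprD mulrACA IH.
have -> : (2 * n.+1 + (ones a n + a n.+1) = (2 * n + ones a n) + (2 + a n.+1))%N by lia.
rewrite (exprD r (2 * n + _)); congr (_ * _).
rewrite /transition forced_initial; case: (boolP (odd n && _)) => [/andP[odd_n an]|_].
  have k_gt0 : (0 < n.+1./2)%N by lia.
  have := Ha _ k_gt0; have -> : (n.+1./2.*2 = n.+1)%N by lia.
  by rewrite an /= => /negPf ->; rewrite mul1r.
by rewrite muln0 expr0 mulr1; case: (a _).
Qed.

Lemma ln_mu_initial a n : golden a ->
  0 < mu (initial a n) /\
  ln (mu (initial a n)) = (2 * n%:R + (ones a n)%:R - 2 * (ones a n./2)%:R) * ln r.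
Proof.
move=> Ha; have mu_n := mu_initial n Ha.
have mu_gt0 : 0 < mu (initial a n).
  have [_ mu_ge0 _] := mu_mass; rewrite lt0r mu_ge0 andbT; apply/eqP => mu0.
  have : 0 < r ^+ (2 * n + ones a n) by rewrite exprn_gt0.
  by rewrite -mu_n mu0 mul0r ltxx.
split=> //; set x := mu _ in mu_n mu_gt0 *.
have ln_prod j k : x * r ^+ j = r ^+ k -> ln x = (k%:R - j%:R) * ln r.
  move=> /(congr1 (@ln R)); rewrite lnM ?posrE ?exprn_gt0 //.
  by rewrite !lnXn // -(mulr_natl _ j) -(mulr_natl _ k) => ln_eq; lra.
by rewrite (ln_prod _ _ mu_n) natrD !natrM.
Qed.

(** The martingale of the ones: each digit minus its conditional expectation. *)
Definition drift u : R :=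
  \sum_(k < size u) ((nth false u k)%:R - transition (take k u) true).

Lemma drift_rcons u b : drift (rcons u b) = drift u + (b%:R - transition u true).
Proof.
rewrite /drift size_rcons big_ord_recr /= nth_rcons ltnn eqxx.
rewrite -cats1 take_size_cat //; congr (_ + _).
by apply: eq_bigr => k _; rewrite nth_cat take_cat !ltn_ord.
Qed.

Lemma drift_initial a n :
  drift (initial a n) = (ones a n)%:R - r ^+ 3 * (n%:R - (ones a n./2)%:R).
Proof.
elim: n => [|n IH]; first by rewrite /drift big_ord0 /ones !big_geq // subr0 mulr0 subr0.
rewrite initialS drift_rcons IH onesS ones_half /transition forced_initial.
by case: (odd n && _); rewrite /= ?natrD -?(natr1 n) ?addn0; lra.
Qed.

(** The exponential change of measure, in a linearized form that keeps it an
    exact transition kernel: the density of [weight (tilted theta)] with respect to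
    [mu] is the product of the factors [1 + theta xi] over the increments [xi]
    of [drift]. *)
Definition tilted theta u b : R :=
  transition u b * (1 + theta * (b%:R - transition u true)).

Lemma transition_le1 u b : transition u b <= 1.
Proof.
have := transition_sum1 u; have := transition_ge0 u true.
by have := transition_ge0 u false; case: b; lra.
Qed.

Lemma tilted_mass theta : `|theta| <= 1 / 2 -> mass_function (weight (tilted theta)).
Proof.
move=> /ler_normlP[theta_ge theta_le]; apply: weight_mass => [u b|u].
  rewrite /tilted mulr_ge0 ?transition_ge0 //.
  by have := transition_ge0 u true; have := transition_le1 u true; case: b => /=; nra.
by rewrite /tilted /=; have := transition_sum1 u; nra.
Qed.

(** This follows from [1 - y <= expR (- y)] at [y = x - 2 x^2], because
    [(1 + x) (1 - y) = 1 + x^2 (1 + 2 x) >= 1]. *)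
Lemma expR_quad_le (x : R) : - (1 / 2) <= x <= 1 / 2 -> expR (x - 2 * x ^+ 2) <= 1 + x.
Proof.
move=> /andP[x_ge x_le].
have : 1 + - (x - 2 * x ^+ 2) <= expR (- (x - 2 * x ^+ 2)) by exact: expR_ge1Dx.
have E_gt0 := expR_gt0 (x - 2 * x ^+ 2).
have := expRxMexpNx_1 (x - 2 * x ^+ 2); set E := expR _ in E_gt0 *; set E' := expR _.
move=> EE' E'_ge.
have y_gt0 : 0 < 1 - x + 2 * x ^+ 2 by nra.
have E_le : E * (1 - x + 2 * x ^+ 2) <= 1 by rewrite -[leRHS]EE' ler_pM2l //; lra.
have : 1 <= (1 + x) * (1 - x + 2 * x ^+ 2).
  have -> : (1 + x) * (1 - x + 2 * x ^+ 2) = 1 + x ^+ 2 * (1 + 2 * x) by ring.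
  by rewrite lerDl mulr_ge0 ?sqr_ge0 //; lra.
by move=> /(le_trans E_le); rewrite ler_pM2r.
Qed.

Lemma tilted_ge theta u : `|theta| <= 1 / 2 ->
  mu u * expR (theta * drift u - 2 * theta ^+ 2 * (size u)%:R) <=
  weight (tilted theta) u.
Proof.
move=> theta_small; have [_ mu_ge0 _] := mu_mass.
elim/last_ind: u => [|u b IH].
  by rewrite /mu /weight /drift !big_ord0 !mulr0 subr0 expR0 mulr1.
rewrite /mu !weight_rcons -/(mu u) drift_rcons size_rcons.
set x := theta * (b%:R - transition u true).
have -> : theta * (drift u + (b%:R - transition u true)) - 2 * theta ^+ 2 * (size u).+1%:R =
    (theta * drift u - 2 * theta ^+ 2 * (size u)%:R) + (x - 2 * theta ^+ 2).
  by rewrite /x -natr1; ring.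
rewrite expRD mulrACA; apply: ler_pM => //.
- by rewrite mulr_ge0 ?expR_ge0.
- by rewrite mulr_ge0 ?expR_ge0 ?transition_ge0.
rewrite /tilted ler_wpM2l ?transition_ge0 // -/x.
have xi_le : -1 <= b%:R - transition u true <= 1.
  by have := transition_ge0 u true; have := transition_le1 u true; case: b {x} => /=; lra.
have x_le : - (1 / 2) <= x <= 1 / 2.
  move/ler_normlP: theta_small => [? ?]; move/andP: xi_le => [? ?]; rewrite /x.
  by apply/andP; split; nra.
apply: le_trans (expR_quad_le x_le); rewrite ler_expR lerD2l lerN2 ler_pM2l //.
by rewrite /x exprMn ler_piMr ?sqr_ge0 //; move/andP: xi_le => [? ?]; nra.
Qed.

(** The tilted measures have total mass 1, and by [tilted_ge] one of the two has
    density at least [expR (e^2 n / 8)] at a word whose drift is large; the sign of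
    [theta] is that of the drift. *)
Lemma drift_tail (e : R) n : 0 < e <= 1 ->
  \sum_(w <- words n | `|drift w| > e * n%:R) mu w <=
  2 * expR (- (e ^+ 2 / 8 * n%:R)).
Proof.
move=> /andP[e_gt0 e_le1]; have [_ mu_ge0 _] := mu_mass.
set T := weight (tilted (e / 4)); set T' := weight (tilted (- (e / 4))).
have small : `|e / 4| <= 1 / 2 by rewrite ger0_norm; lra.
have small' : `|- (e / 4)| <= 1 / 2 by rewrite normrN.
have T_mass := tilted_mass small; have T'_mass := tilted_mass small'.
have [_ T_ge0 _] := T_mass; have [_ T'_ge0 _] := T'_mass.
set d := expR _.
apply: (@le_trans _ _ (\sum_(w <- words n) d * (T w + T' w))); last first.
  by rewrite -big_distrr big_split /= !sum_mass // mulrC.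
rewrite big_seq_cond [leRHS]big_seq [leRHS](bigID (fun w => e * n%:R < `|drift w|)) /=.
apply: ler_wpDr.
  by apply: sumr_ge0 => w _; rewrite mulr_ge0 ?expR_ge0 // addr_ge0.
apply: ler_sum => w /andP[]; rewrite mem_words => /eqP size_w.
rewrite lter_normr => drift_big.
have := tilted_ge w small; have := tilted_ge w small'.
rewrite size_w -/T -/T' => geT' geT.
have bound theta : e ^+ 2 / 8 * n%:R <= theta * drift w - 2 * theta ^+ 2 * n%:R ->
    mu w * expR (theta * drift w - 2 * theta ^+ 2 * n%:R) <= T w + T' w ->
    mu w <= d * (T w + T' w).
  move=> exp_le le_TT.
  have : mu w * expR (e ^+ 2 / 8 * n%:R) <= T w + T' w.
    by apply: le_trans le_TT; rewrite ler_wpM2l // ler_expR.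
  have d_gt0 : 0 < d by exact: expR_gt0.
  by rewrite -ler_pdivrMl // /d -expRN opprK mulrC.
(* [theta = e / 4] maximizes [theta e - 2 theta^2]. *)
have exponent (x : R) : e * n%:R < x ->
    e ^+ 2 / 8 * n%:R <= e / 4 * x - 2 * (e / 4) ^+ 2 * n%:R by nra.
case/orP: drift_big => /exponent exp_le.
  by apply: bound exp_le _; apply: le_trans geT _; rewrite lerDl.
apply: (bound (- (e / 4))); first by rewrite sqrrN mulNr -mulrN.
by apply: le_trans geT' _; rewrite lerDr.
Qed.

(** The deviation of the cylinder mass from [p^n]: the mass is
    [p ^ (n + balance n)]. *)
Definition balance a n : R := (ones a n)%:R / 2 - (ones a n./2)%:R.

(** With [b = r^3 = 1 - p] and [N = ones a], the definition of the drift reads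
    [N n = b (n - N (n/2)) + drift].  The density [c = b - b c / 2] is the fixed
    point of this relation, and [E n = N n - c n] satisfies
    [E n = - b E (n/2) + drift + O(1)] with [b < 1/2], so [E] inherits the linear
    bound of the drift.  The balance is [E n / 2 - E (n/2)] up to a term of the
    right sign. *)
Lemma balance_ge a (e : R) m0 : 0 <= e ->
  (forall n, (m0 <= n)%N -> `|drift (initial a n)| <= e * n%:R) ->
  forall n, - (2 * e * n%:R + 3 * m0.+1%:R) <= balance a n.
Proof.
move=> e_ge0 drift_small.
pose b := r ^+ 3; pose c := 2 * b / (2 + b).
have b_gt0 : 0 < b by rewrite exprn_gt0.
have b_lt : b < 1 / 2 by exact: root_cube_lt_half.
have c_eq : c = b - b * c / 2 by rewrite /c; field; lra.
have c_gt0 : 0 < c by rewrite divr_gt0 //; lra.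
have c_lt : c < 1 / 2 by nra.
have halfE n : exists2 od : R, 0 <= od <= 1 / 2 & n%:R / 2 = (n./2)%:R + od.
  exists ((odd n)%:R / 2); first by case: (odd n) => /=; lra.
  by rewrite -{1}(odd_double_half n) natrD -mul2n natrM; lra.
have drift_le n : `|drift (initial a n)| <= e * n%:R + m0%:R.
  case: (leqP m0 n) => [/drift_small|lt_n]; first by move=> /le_trans; apply; rewrite lerDl.
  apply: (@le_trans _ _ n%:R); last first.
    by rewrite ler_wpDl ?mulr_ge0 // ler_nat ltnW.
  have N_le : (ones a n)%:R <= n%:R :> R by rewrite ler_nat ones_le.
  have H_le : (ones a n./2)%:R <= n%:R :> R.
    by rewrite ler_nat; apply: leq_trans (ones_le _ _) _; lia.
  have N_ge : 0 <= (ones a n)%:R :> R by [].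
  have H_ge : 0 <= (ones a n./2)%:R :> R by [].
  rewrite drift_initial -/b; set N := (ones a n)%:R in N_le N_ge *.
  set H := (ones a n./2)%:R in H_le H_ge *; set m := n%:R in N_le H_le *.
  by rewrite ler_norml; apply/andP; split; nra.
pose E n : R := (ones a n)%:R - c * n%:R.
have E_le n : `|E n| <= 2 * e * n%:R + 2 * m0.+1%:R.
  elim/ltn_ind: n => n IH.
  have [->|n_gt0] := posnP n.
    by rewrite /E /ones big_geq // !mulr0 subrr normr0 add0r mulr_ge0.
  have half_lt : (n./2 < n)%N by lia.
  have := IH _ half_lt; have := drift_le n; rewrite drift_initial -/b.
  have [od z_range n_half] := halfE n.
  have -> : E n = (ones a n)%:R - b * (n%:R - (ones a n./2)%:R) - b * E n./2 + b * c * od.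
    rewrite /E; have -> : od = n%:R / 2 - (n./2)%:R by lra.
    rewrite {1}c_eq; ring.
  set A := (ones a n)%:R - _; set Eh := E n./2.
  rewrite -(natr1 m0) !ler_norml => /andP[? ?] /andP[? ?].
  have bEh : `|b * Eh| <= e * (n./2)%:R + (m0%:R + 1).
    rewrite normrM gtr0_norm //; have : `|Eh| <= 2 * e * (n./2)%:R + 2 * (m0%:R + 1).
      by rewrite ler_norml; apply/andP.
    by have := normr_ge0 Eh; nra.
  move: bEh; rewrite ler_norml => /andP[? ?].
  have bco : 0 <= b * c * od <= 1 / 4.
    have bc_ge : 0 <= b * c by rewrite mulr_ge0 ?ltW.
    have bc_le : b * c <= 1 / 4 by nra.
    move/andP: z_range => [od_ge od_le]; rewrite mulr_ge0 //=.
    by have := ler_pM bc_ge od_ge bc_le od_le; lra.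
  have eh : e * (n./2)%:R <= e * n%:R by rewrite ler_wpM2l // ler_nat ltnW.
  have m0_ge : 0 <= m0%:R :> R by [].
  have en2 : e * n%:R / 2 = e * (n./2)%:R + e * od by rewrite -mulrDr -n_half mulrA.
  have eo : 0 <= e * od by move/andP: z_range => [? ?]; rewrite mulr_ge0.
  by move/andP: bco => [? ?]; apply/andP; split; lra.
move=> n; have := E_le n; have := E_le n./2; have [od /andP[z_ge0 _] n_half] := halfE n.
have -> : balance a n = E n / 2 - E n./2 + c * od.
  rewrite /balance /E; have -> : od = n%:R / 2 - (n./2)%:R by lra.
  by ring.
rewrite !ler_norml => /andP[_ ?] /andP[? _].
have co : 0 <= c * od by rewrite mulr_ge0 // ltW.
have en2 : e * n%:R / 2 = e * (n./2)%:R + e * od by rewrite -mulrDr -n_half mulrA.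
have eo : 0 <= e * od by rewrite mulr_ge0.
lra.
Qed.

(** The threshold [m1] has to be uniform in [a]: the covers of the lower bound are
    chosen, with diameters at most [2^-m1], before the point that they miss. *)
Lemma mu_decay (t : R) : t < - 2 * ln r -> exists2 e, 0 < e <= 1 &
  forall m0, exists m1, forall a, golden a ->
  (forall n, (m0 <= n)%N -> `|drift (initial a n)| <= e * n%:R) ->
  forall n, (m1 <= n)%N -> mu (initial a n) <= expR (- (t * n%:R)).
Proof.
set h := - 2 * ln r => lt_th.
have h_gt0 : 0 < h.
  by have : ln r < 0 by [rewrite ln_lt0 // r_gt0 root_lt1]; rewrite /h; lra.
have ln_r : ln r = - h / 2 by rewrite /h; lra.
clearbody h.
(* [4 h e <= h - t] leaves half of the gap [h - t] to absorb the constant term of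
   the balance; the second summand of the denominator ensures [e <= 1]. *)
pose e := (h - t) / (4 * h + (h - t)).
have den_gt0 : 0 < 4 * h + (h - t) by lra.
have e_gt0 : 0 < e by rewrite divr_gt0 //; lra.
have e_le : 4 * h * e <= h - t.
  have : e * (4 * h + (h - t)) = h - t by rewrite /e mulfVK //; lra.
  by have : 0 <= e * (h - t) by [rewrite mulr_ge0 //; lra]; lra.
exists e; first by rewrite e_gt0 /= /e ler_pdivrMr //; lra.
move=> m0; pose x := 6 * h * m0.+1%:R / (h - t).
have x_ge0 : 0 <= x by rewrite /x !mulr_ge0 ?invr_ge0 ?subr_ge0 ?(ltW h_gt0) ?(ltW lt_th).
exists (Num.bound x) => a Ha drift_small n le_n.
have := balance_ge (ltW e_gt0) drift_small n; rewrite /balance.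
have [mu_gt0 ln_mu] := ln_mu_initial n Ha.
rewrite -[mu _]lnK ?posrE // ler_expR ln_mu => bal.
have x_le : x <= n%:R.
  by apply: ltW; apply: lt_le_trans (archi_boundP x_ge0) _; rewrite ler_nat.
have : 6 * h * m0.+1%:R <= n%:R * (h - t) by rewrite -ler_pdivrMr //; lra.
rewrite ln_r; set N := (ones a n)%:R in bal *; set H := (ones a n./2)%:R in bal *.
set m := n%:R in bal *; set M := m0.+1%:R in bal * => Mle.
have m_ge0 : 0 <= m by [].
have : h * - (2 * e * m + 3 * M) <= h * (N / 2 - H) by rewrite ler_pM2l.
have : 4 * h * e * m <= (h - t) * m by rewrite ler_wpM2r.
lra.
Qed.

End GoldenMeasure.

(** * Points of the set and Hausdorff covers *)

Section Points.
Variable R : realType.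
Implicit Types (a : nat -> bool) (u : seq bool) (x : R).

Lemma partial_sumE a n :
  \sum_(1 <= k < n.+1) (a k)%:R / 2 ^+ k = (binval (initial a n))%:R / 2 ^+ n :> R.
Proof.
elim: n => [|n IH]; first by rewrite big_geq // mul0r.
rewrite big_nat_recr //= IH initialS binval_rcons natrD -mul2n natrM exprS.
by field; rewrite expf_neq0.
Qed.

(** The point [x] has binary expansion [a]; the closed intervals make the two
    expansions of a dyadic number harmless. *)
Definition in_cylinders a x := forall n,
  (binval (initial a n))%:R / 2 ^+ n <= x <= (binval (initial a n)).+1%:R / 2 ^+ n.

Lemma partial_sum_bounds a m n : (m < n)%N ->
  (binval (initial a m))%:R / 2 ^+ m <= (\sum_(1 <= k < n) (a k)%:R / 2 ^+ k : R)
    <= (binval (initial a m)).+1%:R / 2 ^+ m.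
Proof.
case: n => // n; rewrite ltnS => le_mn; rewrite partial_sumE.
have [k ->] : exists k, n = (m + k)%N by exists (n - m)%N; lia.
have pow_gt0 j : 0 < 2 ^+ j :> R by rewrite exprn_gt0.
have scale j : j%:R / 2 ^+ m = (j * 2 ^ k)%:R / 2 ^+ (m + k) :> R.
  by rewrite natrM natrX exprD; field; rewrite !expf_neq0.
have /andP[lo hi] := initial_binval_bounds a m k.
by rewrite !scale !ler_pM2r ?invr_gt0 // !ler_nat lo ltnW.
Qed.

Lemma Xi_G_golden x : Xi_G x -> exists2 a, golden a & in_cylinders a x.
Proof.
move=> [a [a_mul a_cvg]]; exists a => [k k_gt0|n].
  by move/eqP: (a_mul k k_gt0); rewrite mulnb eqb0 mul2n.
have bounds := partial_sum_bounds a (m := n).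
apply/andP; split.
  apply: cvgr_to_ge a_cvg _; exists n.+1 => // j /= lt_nj.
  by have /andP[] := bounds _ lt_nj.
apply: cvgr_to_le a_cvg _; exists n.+1 => // j /= lt_nj.
by have /andP[] := bounds _ lt_nj.
Qed.

Lemma golden_Xi_G a : golden a -> exists2 x, Xi_G x & in_cylinders a x.
Proof.
move=> Ha; pose s n : R := \sum_(1 <= k < n) (a k)%:R / 2 ^+ k.
have s_cvg : cvgn s.
  apply: nondecreasing_is_cvgn.
    apply/nondecreasing_seqP => -[|n]; first by rewrite /s !big_geq.
    by rewrite /s [leRHS]big_nat_recr //= lerDl divr_ge0 // exprn_ge0.
  exists 1 => _ [[|n] _ <-]; first by rewrite /s big_geq.
  by have /andP[_] := partial_sum_bounds a (ltn0Sn n); rewrite divr1.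
exists (limn s).
  exists a; split; last exact: s_cvg.
  by move=> k k_gt0; apply/eqP; rewrite mulnb eqb0 mul2n Ha.
have bounds n := partial_sum_bounds a (m := n).
move=> n; apply/andP; split.
  apply: (limr_ge s_cvg); exists n.+1 => // j /= lt_nj.
  by have /andP[] := bounds _ _ lt_nj.
apply: (limr_le s_cvg); exists n.+1 => // j /= lt_nj.
by have /andP[] := bounds _ _ lt_nj.
Qed.

End Points.

Section Covers.
Variable R : realType.
Implicit Types (A U : set R).
Local Open Scope ereal_scope.

Lemma nneseries_le (f : nat -> \bar R) (c : \bar R) : (forall i, 0 <= f i) ->
  (forall n, \sum_(0 <= i < n) f i <= c) -> \sum_(0 <= i <oo) f i <= c.
Proof.
move=> f_ge0 f_le; apply: lime_le; first exact: is_cvg_nneseries.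
exact: nearW.
Qed.

Lemma diam_le U (d : R) : (forall x y, U x -> U y -> `|x - y|%R <= d)%R ->
  diam U <= d%:E.
Proof. by move=> Ud; apply: ge_ereal_sup => _ [[x y] /= [Ux Uy] <-]; rewrite lee_fin Ud. Qed.

Lemma dist_le_diam U x y : U x -> U y -> `|x - y|%:E <= diam U.
Proof. by move=> Ux Uy; apply: ereal_sup_ubound; exists (x, y). Qed.

Lemma diam_ge0 U : U !=set0 -> 0 <= diam U.
Proof. by move=> [x Ux]; have := dist_le_diam Ux Ux; rewrite subrr normr0. Qed.

Lemma diam_pow_ge0 (s : R) U : 0 <= diam_pow s U.
Proof. by rewrite /diam_pow; case: asboolP => // _; exact: poweR_ge0. Qed.

Lemma diam_pow_le (s d : R) U : (0 <= s)%R -> diam U <= d%:E ->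
  diam_pow s U <= (d `^ s)%:E.
Proof.
move=> s_ge0 le_d; rewrite /diam_pow; case: asboolP => [_|/eqP/set0P U0].
  by rewrite lee_fin powR_ge0.
have diam0 := diam_ge0 U0.
rewrite -poweR_EFin gt0_ler_poweR // !in_itv /= ?leey ?andbT //.
exact: le_trans le_d.
Qed.

Lemma premeasure_ge0 (s d : R) A : 0 <= hausdorff_premeasure s d A.
Proof.
apply: le_ereal_inf_tmp => _ [U _ <-]; apply: nneseries_ge0 => i _ _.
exact: diam_pow_ge0.
Qed.

Lemma hausdorff_measure_eq0 (s : R) A :
  (forall d eta : R, (0 < d)%R -> (0 < eta)%R -> exists U : nat -> set R,
     [/\ forall i, diam (U i) <= d%:E, A `<=` \bigcup_i U i
       & \sum_(0 <= i <oo) diam_pow s (U i) <= eta%:E]) ->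
  hausdorff_measure s A = 0.
Proof.
move=> small; apply/eqP; rewrite eq_le; apply/andP; split.
  apply: ge_ereal_sup => _ [d /= d_gt0 <-].
  apply/lee_addgt0Pr => eta eta_gt0; rewrite add0e.
  have [U [U_diam U_cover U_sum]] := small d eta d_gt0 eta_gt0.
  by apply: le_trans U_sum; apply: ereal_inf_lbound; exists U.
apply: le_trans (premeasure_ge0 s 1%R A) _.
by apply: ereal_sup_ubound; exists 1%R => //=.
Qed.

Lemma hausdorff_measure_cover (s : R) A (d eta : R) :
  hausdorff_measure s A = 0 -> (0 < d)%R -> (0 < eta)%R ->
  exists U : nat -> set R,
    [/\ forall i, diam (U i) <= d%:E, A `<=` \bigcup_i U i
      & \sum_(0 <= i <oo) diam_pow s (U i) < eta%:E].
Proof.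
move=> A_null d_gt0 eta_gt0.
have : hausdorff_premeasure s d A < eta%:E.
  apply: (@le_lt_trans _ _ 0); last by rewrite lte_fin.
  by rewrite -A_null; apply: ereal_sup_ubound; exists d.
by move=> /ereal_inf_lt[_ [U [U_diam U_cover] <-] U_sum]; exists U.
Qed.

End Covers.

(** * Upper bound for the Hausdorff dimension *)

Lemma sum_dyadic (V : nmodType) (f : nat -> V) M :
  \sum_(0 <= i < 2 ^ M) f i =
  f 0 + \sum_(0 <= n < M) \sum_(0 <= N < 2 ^ n) f (2 ^ n + N)%N.
Proof.
elim: M => [|M IH]; first by rewrite expn0 big_nat1 big_geq // addr0.
rewrite big_nat_recr //= addrA -IH (big_cat_nat (n := 2 ^ M)) //=; last first.
  by rewrite leq_exp2l.
congr (_ + _); have -> : (2 ^ M.+1 = 2 ^ M + 2 ^ M)%N by rewrite expnS; lia.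
rewrite -{1}(add0n (2 ^ M)%N) big_addn addKn.
by apply: eq_bigr => N _; rewrite addnC.
Qed.

Lemma trunc_log_dyadic n N : (N < 2 ^ n)%N -> trunc_log 2 (2 ^ n + N) = n.
Proof. by move=> lt_N; apply: trunc_log_eq => //; rewrite expnS; lia. Qed.

Lemma ln2_gt0 (R : realType) : 0 < ln 2 :> R.
Proof. by rewrite ln_gt0 // ltr1n. Qed.

Section HausdorffUpper.
Variables (R : realType) (r : R).
Hypotheses (r_gt0 : 0 < r) (r_root : r ^+ 2 + r ^+ 3 = 1).
Implicit Types (a : nat -> bool) (u w : seq bool).

(** If the balance exceeded [e n] for all large [n], then [ones a n / n] would grow by
    at least [2 e] at each doubling of [n], but it is at most 1. *)
Lemma balance_frequently_le a (e : R) n0 : 0 < e ->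
  exists2 n, (n0 <= n)%N & balance R a n <= e * n%:R.
Proof.
move=> e_gt0; apply: contrapT => no_n.
(* The starting index has to be positive. *)
pose m l := (2 ^ l * n0.+1)%N.
have m_half l : (m l.+1)./2 = m l by rewrite /m expnS; lia.
have m_ge l : (n0 <= m l.+1)%N by rewrite /m; have := expn_gt0 2 l.+1; nia.
have mS l : (m l.+1)%:R = 2 * (m l)%:R :> R by rewrite /m expnS -mulnA natrM.
have ones_ge l : 2 * e * l%:R * (m l)%:R <= (ones a (m l))%:R :> R.
  elim: l => [|l IH]; first by rewrite mulr0 mul0r.
  have : e * (m l.+1)%:R < balance R a (m l.+1).
    by rewrite ltNge; apply/negP => le_e; apply: no_n; exists (m l.+1).
  by rewrite /balance m_half mS -(natr1 l); lra.
have m_gt0 l : 0 < (m l)%:R :> R by rewrite ltr0n /m muln_gt0 expn_gt0.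
have l_bound l : 2 * e * l%:R <= 1.
  rewrite -(ler_pM2r (m_gt0 l)) mul1r; apply: le_trans (ones_ge l) _.
  by rewrite ler_nat ones_le.
have e1_ge0 : 0 <= e^-1 by rewrite invr_ge0 ltW.
have := l_bound (Num.bound e^-1); have := archi_boundP e1_ge0.
set b := (Num.bound _)%:R => lt_b.
have : 1 < e * b by rewrite -(mulfV (lt0r_neq0 e_gt0)) ltr_pM2l.
lra.
Qed.

Lemma mu_frequently_ge a (t : R) n0 : golden a -> - 2 * ln r < t ->
  exists2 n, (n0 <= n)%N & expR (- (t * n%:R)) <= mu r (initial a n).
Proof.
move=> Ha; set h := - 2 * ln r => lt_ht.
have h_gt0 : 0 < h.
  have : ln r < 0 by rewrite ln_lt0 // r_gt0 (root_lt1 r_root).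
  by rewrite /h; lra.
have ln_r : ln r = - h / 2 by rewrite /h; lra.
clearbody h.
have [|n le_n bal] := @balance_frequently_le a ((t - h) / h) n0.
  by rewrite divr_gt0 // subr_gt0.
exists n => //; have [mu_gt0 ln_mu] := ln_mu_initial r_gt0 r_root n Ha.
rewrite -[mu _ _]lnK ?posrE // ler_expR ln_mu ln_r.
move: bal; rewrite mulrAC ler_pdivlMr // /balance; lra.
Qed.

Definition cylinder w : set R :=
  [set x | (binval w)%:R / 2 ^+ size w <= x <= (binval w).+1%:R / 2 ^+ size w].

Lemma expR_ln2 (n : nat) : expR (- (ln 2 * n%:R)) = (2 ^+ n)^-1 :> R.
Proof. by rewrite expRN expRM_natr lnK // posrE. Qed.

Lemma diam_cylinder w : (diam (cylinder w) <= ((2 ^+ size w)^-1)%:E)%E.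
Proof.
apply: diam_le => x y; rewrite /cylinder /= -(natr1 (binval w)) mulrDl mul1r.
by move=> /andP[? ?] /andP[? ?]; rewrite ler_norml; apply/andP; split; lra.
Qed.

Lemma powR_half_pow (t : R) n : ((2 ^+ n)^-1) `^ t = expR (- (t * ln 2 * n%:R)).
Proof. by rewrite -expR_ln2 -expRM; congr expR; ring. Qed.

Lemma geometric_tail (q : R) n0 M : 0 <= q < 1 ->
  \sum_(n0 <= n < M) q ^+ n <= q ^+ n0 / (1 - q).
Proof.
move=> /andP[q_ge0 q_lt1]; have q1_gt0 : 0 < 1 - q by rewrite subr_gt0.
rewrite ler_pdivlMr //; have [le_M|lt_M] := leqP M n0.
  by rewrite big_geq // mul0r exprn_ge0.
have -> : (\sum_(n0 <= n < M) q ^+ n) * (1 - q) = q ^+ n0 - q ^+ M.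
  elim: M lt_M => // M IH; rewrite ltnS leq_eqVlt => /predU1P[<-|lt_M].
    by rewrite big_nat1 exprS; ring.
  by rewrite big_nat_recr ?(ltnW lt_M) //= mulrDl IH // exprS; ring.
by rewrite gerBl exprn_ge0.
Qed.

Lemma expr_small (q e : R) : 0 <= q < 1 -> 0 < e ->
  exists n0, forall n, (n0 <= n)%N -> q ^+ n <= e.
Proof.
move=> /andP[q_ge0 q_lt1] e_gt0.
have q_cvg : q ^+ n @[n --> \oo] --> 0 by apply: cvg_expr; rewrite ger0_norm.
have [N _ HN] := cvgr0_norm_le _ q_cvg _ e_gt0.
by exists N => n le_n; have := HN n le_n; rewrite /= ger0_norm // exprn_ge0.
Qed.

(** At each level [n >= n0] take the cylinders of the words [w] with
    [mu w >= expR (- t' n)], where [t'] lies strictly between the critical value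
    and [t ln 2].  By [mu_frequently_ge] they cover, and as the masses at one
    level add up to 1, their [t]-sum at level [n] is at most
    [expR ((t' - t ln 2) n)]: the total is the tail of a geometric series. *)
Lemma hausdorff_measure_above (t : R) : - 2 * ln r < t * ln 2 ->
  hausdorff_measure t (@Xi_G R) = 0%E.
Proof.
set h := - 2 * ln r => lt_ht.
have h_gt0 : 0 < h.
  have : ln r < 0 by rewrite ln_lt0 // r_gt0 (root_lt1 r_root).
  by rewrite /h; lra.
have ln2_gt0 := ln2_gt0 R.
have t_gt0 : 0 < t by rewrite -(pmulr_lgt0 _ ln2_gt0) (lt_trans h_gt0).
pose t' := (h + t * ln 2) / 2.
have lt_ht' : h < t' by rewrite /t'; lra.
pose q := expR (t' - t * ln 2).
have q_range : 0 <= q < 1 by rewrite expR_ge0 /= expR_lt1 /t'; lra.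
have q1_gt0 : 0 < 1 - q by rewrite subr_gt0; case/andP: q_range.
have [_ mu_ge0 _] := mu_mass r_gt0 r_root.
apply: hausdorff_measure_eq0 => d eta d_gt0 eta_gt0.
have half_range : 0 <= (2^-1 : R) < 1 by lra.
have [n1 n1_small] := expr_small half_range d_gt0.
have [n2 n2_small] := expr_small q_range (mulr_gt0 eta_gt0 q1_gt0).
(* [n0 > 0], as index 0 stands for the empty word without being of the form
   [2^n + N]. *)
pose n0 := maxn n1 n2.+1.
pose heavy w := (n0 <= size w)%N && (expR (- (t' * (size w)%:R)) <= mu r w).
(* The word of length [n] and binary value [N] has index [2^n + N]. *)
pose wrd i := word (trunc_log 2 i) (i - 2 ^ trunc_log 2 i).
have wrdE n N : (N < 2 ^ n)%N -> wrd (2 ^ n + N)%N = word n N.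
  by move=> lt_N; rewrite /wrd trunc_log_dyadic // addKn.
exists (fun i => if heavy (wrd i) then cylinder (wrd i) else set0).
have diam_le_pow i : (diam (if heavy (wrd i) then cylinder (wrd i) else set0)
    <= ((2 ^+ size (wrd i))^-1)%:E)%E.
  case: ifP => _; first exact: diam_cylinder.
  by apply: diam_le => x y [].
split=> [i|x|].
- case: ifP => [/andP[size_ge _]|_]; last by apply: diam_le => x y [].
  apply: le_trans (diam_cylinder _) _; rewrite lee_fin -exprVn.
  by apply: n1_small; apply: leq_trans size_ge; exact: leq_maxl.
- move=> /Xi_G_golden[a Ha x_in].
  have [n le_n mu_big] := mu_frequently_ge n0 Ha lt_ht'.
  exists (2 ^ n + binval (initial a n))%N => //=.
  have -> : wrd (2 ^ n + binval (initial a n))%N = initial a n.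
    have := binval_lt (initial a n); rewrite size_initial => bval_n.
    by rewrite wrdE // -{1}(size_initial a n) word_binval.
  by rewrite /heavy size_initial le_n mu_big /cylinder /= size_initial; exact: x_in.
pose v w : R := if heavy w then expR (- (t * ln 2 * (size w)%:R)) else 0.
have v_ge0 w : 0 <= v w by rewrite /v; case: ifP => // _; exact: expR_ge0.
have diam_pow_v i :
    (diam_pow t (if heavy (wrd i) then cylinder (wrd i) else set0) <= (v (wrd i))%:E)%E.
  rewrite /v; case: ifP => _.
    rewrite -powR_half_pow; apply: diam_pow_le (ltW t_gt0) _.
    exact: diam_cylinder.
  by rewrite /diam_pow; case: asboolP.
apply: nneseries_le => [i|K]; first exact: diam_pow_ge0.
apply: le_trans (lee_sum _ (fun i _ => diam_pow_v i)) _.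
rewrite sumEFin lee_fin.
apply: (@le_trans _ _ (\sum_(0 <= i < 2 ^ K) v (wrd i))).
  have le_K : (K <= 2 ^ K)%N by rewrite ltnW // ltn_expl.
  by rewrite [leRHS](big_cat_nat (n := K)) //= lerDl sumr_ge0.
rewrite sum_dyadic.
have -> : v (wrd 0) = 0 by rewrite /v /heavy /wrd /= /n0 leqNgt leq_max ltn0Sn orbT.
rewrite add0r; apply: (@le_trans _ _ (\sum_(0 <= n < K) \sum_(w <- words n) v w)).
  apply: ler_sum => n _; rewrite sum_words_nat big_nat [leRHS]big_nat.
  by apply: ler_sum => N /andP[_ lt_N]; rewrite wrdE.
have level n : \sum_(w <- words n) v w <= if (n0 <= n)%N then q ^+ n else 0.
  case: ifP => [le_n|/negbT lt_n]; last first.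
    rewrite big_seq big1 // => w; rewrite mem_words => /eqP size_w.
    by rewrite /v /heavy size_w (negPf lt_n).
  have -> : q ^+ n = \sum_(w <- words n) q ^+ n * mu r w.
    by rewrite -big_distrr /= (sum_mass _ (mu_mass r_gt0 r_root)) mulr1.
  rewrite !big_seq; apply: ler_sum => w; rewrite mem_words => /eqP size_w.
  rewrite /v; case: ifP => [/andP[_]|_]; last by rewrite mulr_ge0 // exprn_ge0 ?expR_ge0.
  rewrite size_w => mu_big.
  have -> : - (t * ln 2 * n%:R) = (t' - t * ln 2) * n%:R + - (t' * n%:R) by ring.
  by rewrite expRD expRM_natr ler_wpM2l // exprn_ge0 ?expR_ge0.
apply: le_trans (ler_sum _ (fun n _ => level n)) _.
rewrite -big_mkcond /=.
apply: (@le_trans _ _ (\sum_(n0 <= n < K) q ^+ n)).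
  have [le_K|lt_K] := leqP K n0.
    rewrite big_nat_cond big1 ?big_geq // => n /andP[/andP[_ lt_n]].
    by move=> le_n; have := leq_trans (leq_trans lt_n le_K) le_n; rewrite ltnn.
  by rewrite (big_nat_widenl n0 0) // .
apply: le_trans (geometric_tail _ _ q_range) _.
rewrite ler_pdivrMr //; apply: n2_small.
by rewrite /n0 leq_max leqnSn orbT.
Qed.

End HausdorffUpper.

(** * Lower bound for the Hausdorff dimension *)

Section HausdorffLower.
Variables (R : realType) (r : R).
Hypotheses (r_gt0 : 0 < r) (r_root : r ^+ 2 + r ^+ 3 = 1).
Implicit Types (a : nat -> bool) (u w : seq bool).

(** The extra [e] takes care of sets of diameter 0, for which no level is the
    right one. *)
Lemma dyadic_level (D t e : R) m1 : 0 <= D <= (2 ^+ m1)^-1 -> 0 <= t -> 0 < e ->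
  exists m, [/\ (m1 <= m)%N, D <= (2 ^+ m)^-1
    & expR (- (t * ln 2 * m%:R)) <= expR (t * ln 2) * D `^ t + e].
Proof.
move=> /andP[D_ge0 D_le] t_ge0 e_gt0.
have [t0|t_neq0] := eqVneq t 0.
  exists m1; split=> //; rewrite t0 !mul0r oppr0 expR0 powRr0 mulr1 lerDl; exact: ltW.
have t_gt0 : 0 < t by rewrite lt0r t_neq0.
have half_range : 0 <= (2^-1 : R) < 1 by lra.
have [D0|D_neq0] := eqVneq D 0.
  have q_range : 0 <= expR (- (t * ln 2)) < 1.
    by rewrite expR_ge0 expR_lt1 oppr_lt0 mulr_gt0 // ln2_gt0.
  have [n small_n] := expr_small q_range e_gt0.
  exists (maxn m1 n); split; first exact: leq_maxl.
    by rewrite D0 invr_ge0 exprn_ge0.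
  rewrite D0 powR0 // mulr0 add0r -mulNr expRM_natr.
  by apply: small_n; exact: leq_maxr.
have D_gt0 : 0 < D by rewrite lt0r D_neq0.
have D2_gt0 : 0 < D / 2 by rewrite divr_gt0.
have [n small_n] := expr_small half_range D2_gt0.
pose P m := D <= (2 ^+ m)^-1.
have P_bound m : P m -> (m <= n)%N.
  rewrite /P => Pm; rewrite leqNgt; apply/negP => lt_nm.
  by have := small_n m (ltnW lt_nm); rewrite exprVn; lra.
have exP : exists m, P m by exists m1.
case: (ex_maxnP exP P_bound) => m Pm m_max.
exists m; split=> //; first exact: m_max.
have lt_D : (2 ^+ m.+1)^-1 < D.
  by rewrite ltNge; apply/negP => /m_max; rewrite ltnn.
have -> : - (t * ln 2 * m%:R) = t * ln 2 + - (t * ln 2 * m.+1%:R).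
  by rewrite -(natr1 m); ring.
rewrite expRD ler_wpDr ?(ltW e_gt0) // ler_wpM2l ?expR_ge0 // -powR_half_pow.
by rewrite ge0_ler_powR ?nnegrE ?invr_ge0 ?exprn_ge0 // ltW.
Qed.

Lemma near_index x y : (x <= y.+2)%N -> (y <= x.+2)%N ->
  (y - 2 + (x - (y - 2)) = x)%N /\ (x - (y - 2) < 5)%N.
Proof. by lia. Qed.

(** A set of diameter at most [2^-m] meets the cylinders of length [m] of at most
    five words: the binary values differ by at most 2 from the value at a
    reference point of the set. *)
Lemma cover_words (U : set R) (t e : R) m1 :
  (diam U <= ((2 ^+ m1)^-1)%:E)%E -> 0 <= t -> 0 < e ->
  exists mws : nat * seq (seq bool),
    [/\ (m1 <= mws.1)%N,
        forall x a, U x -> in_cylinders a x -> initial a mws.1 \in mws.2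
      & (size mws.2)%:R * expR (- (t * ln 2 * mws.1%:R)) <=
        5 * (expR (t * ln 2) * fine (diam_pow t U) + e)].
Proof.
move=> U_diam t_ge0 e_gt0.
have fine_ge0 : 0 <= fine (diam_pow t U) by rewrite fine_ge0 ?diam_pow_ge0.
have [[x0 [b [Ux0 x0_b]]]|no_point] :=
    pselect (exists x b, U x /\ in_cylinders b x); last first.
  exists (m1, [::]); split=> //= [x a Ux x_a|].
    by case: no_point; exists x, a.
  by rewrite mul0r mulr_ge0 // addr_ge0 ?mulr_ge0 ?expR_ge0 // ltW.
have diam0 : (0 <= diam U)%E by apply: diam_ge0; exists x0.
have diam_fin : diam U \is a fin_num.
  by rewrite ge0_fin_numE // (le_lt_trans U_diam) // ltry.
have [D defD] : exists D, diam U = D%:E by exists (fine (diam U)); rewrite fineK.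
have pow_D : fine (diam_pow t U) = D `^ t.
  rewrite /diam_pow; case: asboolP => [U0|_]; first by move: Ux0; rewrite U0.
  by rewrite defD poweR_EFin.
have D_range : 0 <= D <= (2 ^+ m1)^-1.
  by rewrite -!lee_fin -defD diam0.
have [m [le_m D_le exp_le]] := dyadic_level D_range t_ge0 e_gt0.
pose k := (binval (initial b m) - 2)%N.
pose L := [seq word m (k + j) | j <- iota 0 5].
exists (m, L); split=> //=; last first.
  by rewrite ler_wpM2l // pow_D.
move=> x a Ux x_a.
have xx0 : `|x - x0| <= (2 ^+ m)^-1.
  by apply: le_trans D_le; rewrite -lee_fin -defD dist_le_diam.
have pow_gt0 : 0 < 2 ^+ m :> R by rewrite exprn_gt0.
have /andP[a_lo a_hi] := x_a m; have /andP[b_lo b_hi] := x0_b m.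
move: a_lo a_hi b_lo b_hi.
rewrite !ler_pdivrMr // !ler_pdivlMr // => a_lo a_hi b_lo b_hi.
have : `|x * 2 ^+ m - x0 * 2 ^+ m| <= 1.
  by rewrite -mulrBl normrM (gtr0_norm pow_gt0) -ler_pdivlMr // mul1r.
rewrite ler_norml.
set na := binval (initial a m) in a_lo a_hi *; set nb := binval (initial b m) in b_lo b_hi *.
move=> /andP[lo hi].
have le1 : (na <= nb.+2)%N.
  by rewrite -(ler_nat R) -(natr1 nb.+1); lra.
have le2 : (nb <= na.+2)%N.
  by rewrite -(ler_nat R) -(natr1 na.+1); lra.
have [sum_k lt5] := near_index le1 le2.
have -> : initial a m = word m (k + (na - k)).
  by rewrite /k sum_k; have := word_binval (initial a m); rewrite size_initial.
by apply: (map_f (fun j => word m (k + j))); rewrite mem_iota.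
Qed.

(** The mass distribution principle.  The forbidden words are those with a large
    drift at some level [i >= m0], of total mass at most 1/4, and those of small mass
    whose cylinder meets a set of an efficient cover, of total mass at most 1/2.  A
    sequence that avoids them has, by the first condition, initial words of
    small mass; by the second one its point is not covered. *)
Lemma hausdorff_measure_below (t : R) : 0 <= t -> t * ln 2 < - 2 * ln r ->
  hausdorff_measure t (@Xi_G R) <> 0%E.
Proof.
move=> t_ge0 lt_th null.
have [_ mu_ge0 _] := mu_mass r_gt0 r_root.
have [e e_range decay] := mu_decay r_gt0 r_root lt_th.
have /andP[e_gt0 _] := e_range.
pose q := expR (- (e ^+ 2 / 8)).
have q_range : 0 <= q < 1.
  by rewrite expR_ge0 expR_lt1 oppr_lt0 divr_gt0 ?exprn_gt0.
have q1_gt0 : 0 < 1 - q by rewrite subr_gt0; case/andP: q_range.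
(* The tail [2 q^m0 / (1 - q)] of the masses of large drift is at most 1/4. *)
have eighth : 0 < (1 - q) / 8 by rewrite divr_gt0.
have [m0 small_m0] := expr_small q_range eighth.
have [m1 {}decay] := decay m0.
pose d : R := (2 ^+ m1)^-1.
have d_gt0 : 0 < d by rewrite invr_gt0 exprn_gt0.
(* The cover contributes [5 expR (t ln 2) eta <= 1/4], and the errors [ei] sum up
   to at most [5 / 20 = 1/4]. *)
pose eta := (20 * expR (t * ln 2))^-1.
have eta_gt0 : 0 < eta by rewrite invr_gt0 mulr_gt0 ?expR_gt0.
have [U [U_diam U_cover U_sum]] := hausdorff_measure_cover null d_gt0 eta_gt0.
pose ei i : R := 2^-1 ^+ i.+1 / 20.
have ei_gt0 i : 0 < ei i by rewrite divr_gt0 // exprn_gt0.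
have [f Hf] := choice (fun i => cover_words (U_diam i) t_ge0 (ei_gt0 i)).
pose bad i := if (m0 <= i)%N then
  [seq w <- words i | e * i%:R < `|drift r w|] else [::].
pose ws i := bad i ++
  [seq w <- (f i).2 | mu r w <= expR (- (t * ln 2 * (f i).1%:R))].
have sum_bad M : \sum_(0 <= i < M) \sum_(w <- bad i) mu r w <= 1 / 4.
  have bad_le i : \sum_(w <- bad i) mu r w <= if (m0 <= i)%N then 2 * q ^+ i else 0.
    rewrite /bad; case: ifP => _; last by rewrite big_nil.
    rewrite big_filter; apply: le_trans (drift_tail r_gt0 r_root i e_range) _.
    by rewrite -mulNr expRM_natr.
  apply: le_trans (ler_sum _ (fun i _ => bad_le i)) _.
  rewrite -big_mkcond /=.
  have -> : \sum_(0 <= i < M | (m0 <= i)%N) 2 * q ^+ i =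
      2 * \sum_(m0 <= i < M) q ^+ i.
    by rewrite (big_nat_widenl m0 0) // big_distrr.
  have := geometric_tail m0 M q_range.
  have : q ^+ m0 / (1 - q) <= 1 / 8.
    by rewrite ler_pdivrMr //; have := small_m0 m0 (leqnn _); lra.
  lra.
have sum_cover M : \sum_(0 <= i < M) 5 * (expR (t * ln 2) * fine (diam_pow t (U i)) + ei i)
    <= 1 / 2.
  rewrite -big_distrr /= big_split /= -big_distrr /=.
  have fine_sum : \sum_(0 <= i < M) fine (diam_pow t (U i)) <= eta.
    rewrite -lee_fin -sumEFin; apply: le_trans (ltW U_sum).
    apply: le_trans (nneseries_lim_ge M _); last by move=> i _ _; exact: diam_pow_ge0.
    apply: lee_sum => i _; rewrite fineK //.
    rewrite ge0_fin_numE ?diam_pow_ge0 //.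
    by apply: le_lt_trans (diam_pow_le t_ge0 (U_diam i)) _; rewrite ltry.
  have ei_sum : \sum_(0 <= i < M) ei i <= 1 / 20.
    rewrite /ei -big_distrl /= ler_pM2r ?invr_gt0 //.
    have -> : \sum_(0 <= i < M) (2^-1 : R) ^+ i.+1 = 1 - 2^-1 ^+ M.
      elim: (M) => [|j IH]; first by rewrite big_geq // subrr.
      by rewrite big_nat_recr //= IH exprS; lra.
    by rewrite gerBl exprn_ge0.
  have E_gt0 := expR_gt0 (t * ln 2).
  have : expR (t * ln 2) * \sum_(0 <= i < M) fine (diam_pow t (U i)) <= 1 / 20.
    have -> : 1 / 20 = expR (t * ln 2) * eta.
      by rewrite /eta; field; rewrite gt_eqF.
    by rewrite ler_pM2l.
  lra.
have sum_ws M : \sum_(0 <= i < M) \sum_(w <- ws i) mu r w <= 3 / 4.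
  have ws_le i : \sum_(w <- ws i) mu r w <= \sum_(w <- bad i) mu r w +
      5 * (expR (t * ln 2) * fine (diam_pow t (U i)) + ei i).
    rewrite /ws big_cat lerD2l /= big_filter.
    have [_ _ size_le] := Hf i; apply: le_trans size_le.
    have -> (c : R) : (size (f i).2)%:R * c = \sum_(w <- (f i).2) c.
      by rewrite big_const_seq count_predT iter_addr_0 mulr_natl.
    rewrite big_mkcond /=.
    apply: ler_sum => w _; case: ifP => // _; exact: expR_ge0.
  apply: le_trans (ler_sum _ (fun i _ => ws_le i)) _.
  by rewrite big_split /=; have := sum_bad M; have := sum_cover M; lra.
have q34 : 3 / 4 < 1 :> R by lra.
have [a [mu_a_gt0 a_avoids]] := avoid_words (mu_mass r_gt0 r_root) sum_ws q34.
have a_golden : golden a.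
  by apply: initial_admissible => n; exact: mu_gt0_admissible (mu_a_gt0 n).
have a_decay : forall n, (m1 <= n)%N -> mu r (initial a n) <= expR (- (t * ln 2 * n%:R)).
  apply: decay => // n le_n; rewrite leNgt; apply/negP => drift_big.
  have /negP[] := a_avoids n n.
  by rewrite mem_cat /bad le_n mem_filter drift_big mem_words size_initial eqxx.
have [x Xx x_a] := golden_Xi_G R a_golden.
have [i _ Uix] := U_cover x Xx.
have [le_m1 in_words _] := Hf i.
have /negP[] := a_avoids i (f i).1.
by rewrite mem_cat mem_filter (in_words x a) // a_decay // orbT.
Qed.

Lemma hausdorff_dim_Xi_G : hausdorff_dim (@Xi_G R) = (- 2 * ln r / ln 2)%:E.
Proof.
have ln2 := ln2_gt0 R.
have h_gt0 : 0 < - 2 * ln r.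
  have : ln r < 0 by rewrite ln_lt0 // r_gt0 (root_lt1 r_root).
  lra.
apply/eqP; rewrite eq_le; apply/andP; split.
  apply/lee_addgt0Pr => e e_gt0; apply: ereal_inf_lbound.
  exists (- 2 * ln r / ln 2 + e) => //=; split.
    by rewrite addr_ge0 ?divr_ge0 // ltW.
  apply: hausdorff_measure_above r_gt0 r_root _ _.
  by rewrite mulrDl mulfVK ?gt_eqF // ltrDl mulr_gt0.
apply: le_ereal_inf_tmp => _ [t /= [t_ge0 t_null] <-].
rewrite lee_fin leNgt; apply/negP; rewrite ltr_pdivlMr // => lt_t.
exact: hausdorff_measure_below t_ge0 lt_t t_null.
Qed.

End HausdorffLower.

(** * Counting admissible words *)

Section Counting.
Local Open Scope nat_scope.
Implicit Types (u w : seq bool) (n i : nat).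

Fixpoint fibo n :=
  if n is n'.+1 then (if n' is m.+1 then fibo n' + fibo m else 1) else 1.

Arguments fibo n : simpl never.

Lemma fiboSS n : fibo n.+2 = fibo n.+1 + fibo n.
Proof. by []. Qed.

Lemma fibo_gt0 n : 0 < fibo n.
Proof. by elim/ltn_ind: n => -[|[|n]] // IH; rewrite fiboSS addn_gt0 IH. Qed.

Lemma fibo_leS n : fibo n <= fibo n.+1.
Proof. by case: n => // n; rewrite fiboSS leq_addr. Qed.

Lemma fibo_double n : fibo n.+1 <= 2 * fibo n.
Proof. by case: n => // n; rewrite fiboSS mul2n -addnn leq_add2l fibo_leS. Qed.

(** The number of elements of [i, 2i, 4i, ...] that are at most [n]. *)
Definition chain_length n i := if 0 < i <= n then (trunc_log 2 (n %/ i)).+1 else 0.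

Lemma chain_length_half n i : chain_length n i.*2 = chain_length n./2 i.
Proof.
rewrite /chain_length double_gt0.
have -> : (i.*2 <= n) = (i <= n./2) by lia.
by case: ifP => // _; rewrite -mul2n divnMA divn2.
Qed.

Lemma chain_length_double n i : 0 < i <= n -> chain_length n i = (chain_length n i.*2).+1.
Proof.
move=> /andP[i_gt0 le_in]; rewrite chain_length_half /chain_length i_gt0 le_in /=.
have [le_i|lt_i] := leqP i n./2.
  rewrite trunc_log2S; last by rewrite leq_divRL //; lia.
  by rewrite -divn2 -divnMA mulnC divnMA divn2.
have -> : n %/ i = 1.
  apply/eqP; rewrite eqn_leq leq_divRL // mul1n le_in andbT.
  by rewrite -ltnS ltn_divLR //; lia.
by rewrite trunc_log1.
Qed.

(** Chains that have been entered but not completed by [u]: [i] is the last element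
    of its chain inside [u].  If [l] is the number of elements from [i] onwards,
    the [l - 1] later ones can be filled in [fibo l] ways after a 0 and in
    [fibo (l - 1)] ways after a 1. *)
Definition open_chains n u :=
  \prod_(uphalf (size u).+1 <= i < (size u).+1) fibo (chain_length n i - digit u i).

(** Chains that start after position [k]. *)
Definition new_chains n k := \prod_(k.+1 <= i < n.+1 | odd i) fibo (chain_length n i).+1.

Definition extensions n u := admissible u * (open_chains n u * new_chains n (size u)).

Lemma digit_rcons u b i : digit (rcons u b) i =
  if i <= size u then digit u i else (i == (size u).+1) && b.
Proof.
rewrite /digit; case: i => // i /=; rewrite nth_rcons ltnNge eqSS.
by case: ltngtP.
Qed.

(** Reading the digit at [k = size u + 1] starts a new chain when [k] is odd, and
    otherwise advances the chain whose last element was [k/2]; in both cases the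
    identity is the Fibonacci recursion. *)
Lemma extensionsE n u : size u < n ->
  extensions n u = extensions n (rcons u false) + extensions n (rcons u true).
Proof.
move=> lt_un; set k := (size u).+1.
have k_range : 0 < k <= n by [].
(* The chains that are open, in the same state, before and after the digit [k]. *)
pose C := \prod_(uphalf k.+1 <= i < k) fibo (chain_length n i - digit u i).
have open_rcons b : open_chains n (rcons u b) = C * fibo (chain_length n k - b).
  rewrite /open_chains size_rcons -/k big_nat_recr /=; last by rewrite /k /=; lia.
  rewrite digit_rcons -/k ltnn eqxx; congr (_ * _).
  by apply: eq_big_nat => i /andP[_ lt_ik]; rewrite digit_rcons -ltnS lt_ik.
have new_k : new_chains n (size u) =
    (if odd k then fibo (chain_length n k).+1 else 1) * new_chains n k.
  by rewrite /new_chains big_ltn_cond //; case: ifP; rewrite ?mul1n.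
have chain_length_gt0 : 0 < chain_length n k by rewrite /chain_length k_range.
have fibo_length : fibo (chain_length n k).+1 =
    fibo (chain_length n k) + fibo (chain_length n k - 1).
  by case: (chain_length n k) chain_length_gt0 => // j _; rewrite fiboSS subn1.
have forced_u : forced u = odd (size u) && digit u k./2 by [].
rewrite /extensions !open_rcons !size_rcons new_k !admissible_rcons forced_u -/k.
move: (new_chains n k) (admissible u) => later A.
case: (boolP (odd (size u))) => odd_u.
  have odd_k : odd k = false by rewrite /k /= odd_u.
  have open_k : open_chains n u = fibo ((chain_length n k).+1 - digit u k./2) * C.
    have half_k : k./2.*2 = k by rewrite /k; lia.
    rewrite /open_chains -/k /C.
    have -> : uphalf k = k./2 by rewrite /k; lia.
    have -> : uphalf k.+1 = k./2.+1 by rewrite /k; lia.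
    rewrite big_ltn; last by rewrite /k; lia.
    by rewrite chain_length_double ?half_k //; rewrite /k; lia.
  rewrite open_k odd_k; case: (digit u k./2); case: A => //=.
    by rewrite subn1 subn0 /=; lia.
  by rewrite !subn0 fibo_length; lia.
have odd_k : odd k by rewrite /k /= odd_u.
have open_k : open_chains n u = C.
  rewrite /open_chains -/k /C; congr (\prod_(_ <= i < k) _).
  by rewrite /k; lia.
rewrite open_k odd_k fibo_length; case: A => //=.
by rewrite subn0; lia.
Qed.

Definition count_admissible n := size [seq w <- words n | admissible w].

Lemma count_admissibleE n :
  count_admissible n = \prod_(1 <= i < n.+1 | odd i) fibo (chain_length n i).+1.
Proof.
have -> : count_admissible n = \sum_(w <- words n) extensions n w.
  rewrite /count_admissible size_filter -sum1_count big_mkcond /= !big_seq.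
  apply: eq_bigr => w; rewrite mem_words => /eqP size_w.
  have new_1 : new_chains n n = 1 by rewrite /new_chains big_geq.
  rewrite /extensions /open_chains size_w new_1 muln1.
  rewrite big_nat big1 ?muln1 => [|i /andP[lo hi]]; first by case: (admissible w).
  rewrite chain_length_double; last by lia.
  have -> : chain_length n i.*2 = 0 by rewrite /chain_length; case: ifP => //; lia.
  by case: (digit w i).
rewrite (sum_words_additive (V := nat) (@extensionsE n)).
by rewrite /extensions /open_chains big_geq // mul1n mul1n.
Qed.

End Counting.

(** * Growth rate of the number of admissible words *)

Section Asymptotics.
Variable R : realType.
Implicit Types (psi : nat -> R) (B : R).

Definition chain_sum psi n : R :=
  \sum_(1 <= i < n.+1 | odd i) (psi (chain_length n i) - psi 0).

Definition shift psi j := psi j.+1.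

Definition steps_in B psi := forall j, 0 <= psi j.+1 - psi j <= B.

Lemma sum_odd n (c : R) : \sum_(1 <= i < n.+1 | odd i) c = (uphalf n)%:R * c.
Proof.
elim: n => [|n IH]; first by rewrite big_geq // mul0r.
rewrite big_mkcond big_nat_recr //= -big_mkcond IH.
have -> : (n./2).+1 = (uphalf n + ~~ odd n)%N by lia.
by rewrite natrD mulrDl; case: (odd n); rewrite /= ?mul1r ?mul0r.
Qed.

(** For [i <= n] the chain of [i] below [n] is one longer than its chain below
    [n/2], even when the latter is empty. *)
Lemma chain_sum_half psi n :
  chain_sum psi n = chain_sum (shift psi) n./2 + (uphalf n)%:R * (psi 1 - psi 0).
Proof.
have -> : chain_sum (shift psi) n./2 =
    \sum_(1 <= i < n.+1 | odd i) (shift psi (chain_length n./2 i) - shift psi 0).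
  rewrite [RHS](big_cat_nat (n := n./2.+1)) //=; last by lia.
  rewrite [X in _ + X]big_nat_cond [X in _ + X]big1 ?addr0 // => i.
  move=> /andP[/andP[lt_i _] _]; rewrite /chain_length.
  by rewrite (leqNgt i) lt_i andbF subrr.
rewrite -sum_odd -big_split /= /chain_sum [LHS]big_nat_cond [RHS]big_nat_cond.
apply: eq_bigr => i /andP[/andP[i_gt0 le_i] _].
by rewrite chain_length_double ?i_gt0 // chain_length_half /shift; ring.
Qed.

Lemma chain_sum_bounds B psi n : steps_in B psi -> 0 <= chain_sum psi n <= B * n%:R.
Proof.
elim/ltn_ind: n psi => n IH psi step.
have [->|n_gt0] := posnP n; first by rewrite /chain_sum big_geq // mulr0 lexx.
have half_lt : (n./2 < n)%N by lia.
have /andP[lo hi] := IH _ half_lt (shift psi) (fun j => step j.+1).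
have /andP[step_ge step_le] := step 0%N.
rewrite chain_sum_half; apply/andP; split; first by rewrite addr_ge0 ?mulr_ge0.
have -> : n%:R = (n./2)%:R + (uphalf n)%:R :> R by rewrite -natrD; congr (_%:R); lia.
by rewrite (mulrDr B) lerD // (mulrC B) ler_wpM2l.
Qed.

Definition limit_sum psi J : R :=
  \sum_(0 <= j < J) (psi j.+1 - psi j) / 2 ^+ j.+1.

Lemma limit_sum_tail B psi J J' : steps_in B psi -> (J <= J')%N ->
  limit_sum psi J <= limit_sum psi J' <= limit_sum psi J + B / 2 ^+ J.
Proof.
move=> step le_J; have B_ge0 : 0 <= B by have /andP[/le_trans] := step 0%N; apply.
suff : limit_sum psi J <= limit_sum psi J' <=
    limit_sum psi J + B * ((2 ^+ J)^-1 - (2 ^+ J')^-1).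
  move=> /andP[-> /le_trans]; apply; rewrite lerD2l ler_wpM2l //.
  by rewrite gerBl invr_ge0 exprn_ge0.
rewrite -(subnKC le_J); elim: (J' - J)%N => [|k /andP[lo hi]].
  by rewrite addn0 subrr mulr0 addr0 lexx.
have /andP[step_ge step_le] := step (J + k)%N.
have pow_gt0 : 0 < (2 ^+ (J + k).+1)^-1 :> R by rewrite invr_gt0 exprn_gt0.
have pow_eq : (2 ^+ (J + k))^-1 = 2 * (2 ^+ (J + k).+1)^-1 :> R.
  by rewrite exprS; field; rewrite expf_neq0.
rewrite addnS /limit_sum big_nat_recr //= -/(limit_sum psi (J + k)) -/(limit_sum psi J).
rewrite pow_eq in hi; apply/andP; split.
  by apply: le_trans lo _; rewrite lerDl mulr_ge0 // ltW.
apply: le_trans (lerD hi (ler_wpM2r (ltW pow_gt0) step_le)) _.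
by set p := (2 ^+ (J + k).+1)^-1; set q := (2 ^+ J)^-1; lra.
Qed.

(** Induction on [J], with [psi] shifted by one and [n] halved at each step.  Each
    halving costs a rounding error of at most [B], and the remainder after [J]
    steps is bounded by [B n / 2^J]. *)
Lemma chain_sum_approx B psi n J : steps_in B psi ->
  `|chain_sum psi n - n%:R * limit_sum psi J| <= B * (J%:R + n%:R / 2 ^+ J).
Proof.
elim: J psi n => [|J IH] psi n step.
  rewrite /limit_sum big_geq // mulr0 subr0 add0r divr1.
  by have /andP[lo hi] := chain_sum_bounds n step; rewrite ger0_norm.
have shift_step : steps_in B (shift psi) by move=> j; exact: step.
have := IH _ n./2 shift_step.
have lim_shift : limit_sum psi J.+1 =
    (psi 1 - psi 0) / 2 + limit_sum (shift psi) J / 2.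
  rewrite /limit_sum big_nat_recl //= expr1; congr (_ + _).
  rewrite big_distrl /=; apply: eq_bigr => j _.
  by rewrite /shift exprS; field; rewrite expf_neq0.
have /andP[step_ge step_le] := step 0%N.
have lim0 : limit_sum (shift psi) 0 = 0 by rewrite /limit_sum big_geq.
have /andP[lim_ge lim_le] := limit_sum_tail shift_step (leq0n J).
rewrite lim0 in lim_ge lim_le; rewrite expr0 divr1 add0r in lim_le.
rewrite lim_shift (chain_sum_half psi n).
have n_eq : n%:R = 2 * (n./2)%:R + (odd n)%:R :> R.
  by rewrite -natrM -natrD; congr (_%:R); lia.
have -> : (uphalf n)%:R = (n./2)%:R + (odd n)%:R :> R.
  by rewrite -natrD; congr (_%:R); lia.
set T := chain_sum _ _; set L := limit_sum (shift psi) J in lim_ge lim_le *.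
set h := (n./2)%:R in n_eq *; set p := psi 1 - psi 0 in step_ge step_le *.
set od : R := (odd n)%:R in n_eq *.
have od_ge : 0 <= od by [].
have od_le : od <= 1 by rewrite /od; case: (odd n).
rewrite ler_norml => /andP[lo hi].
have pow_gt0 : 0 < 2 ^+ J :> R by rewrite exprn_gt0.
have half_pow : B * (h / 2 ^+ J) <= B * (n%:R / 2 ^+ J.+1).
  rewrite ler_wpM2l ?(le_trans step_ge) //.
  have -> : h / 2 ^+ J = (2 * h) / 2 ^+ J.+1.
    by rewrite exprS; field; rewrite gt_eqF.
  by rewrite ler_wpM2r ?invr_ge0 ?exprn_ge0 // n_eq lerDl.
have -> : T + (h + od) * p - n%:R * (p / 2 + L / 2) =
    (T - h * L) + od * (p - L) / 2 by rewrite n_eq; field.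
have odd_le : `|od * (p - L) / 2| <= B.
  rewrite ler_norml; apply/andP; split; nra.
move: odd_le; rewrite !ler_norml -(natr1 J) => /andP[olo ohi].
by apply/andP; split; lra.
Qed.

Lemma chain_sum_asymp B psi : steps_in B psi -> exists2 Lam,
  forall J, limit_sum psi J <= Lam &
  forall d, 0 < d -> exists K, forall n, `|chain_sum psi n - n%:R * Lam| <= d * n%:R + K.
Proof.
move=> step; have B_ge0 : 0 <= B by have /andP[/le_trans] := step 0%N; apply.
pose Lam := sup (range (limit_sum psi)).
have lim_le J J' : limit_sum psi J' <= limit_sum psi J + B / 2 ^+ J.
  have [le_J|lt_J] := leqP J J'; first by have /andP[] := limit_sum_tail step le_J.
  have /andP[/le_trans le_lim _] := limit_sum_tail step (ltnW lt_J); apply: le_lim.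
  by rewrite lerDl divr_ge0 ?exprn_ge0.
have Lam_ge J : limit_sum psi J <= Lam.
  apply: ub_le_sup; last by exists J.
  by exists (limit_sum psi 0 + B / 2 ^+ 0) => _ [j _ <-].
have Lam_le J : Lam <= limit_sum psi J + B / 2 ^+ J.
  by apply: ge_sup; [exists (limit_sum psi 0), 0%N | move=> _ [j _ <-]].
exists Lam => // d d_gt0.
have half_range : 0 <= (2^-1 : R) < 1 by lra.
have dB_gt0 : 0 < d / (2 * B + 1) by rewrite divr_gt0 //; lra.
have [J small_J] := expr_small half_range dB_gt0.
exists (B * J%:R) => n; have := chain_sum_approx n J step.
have := small_J J (leqnn J); rewrite exprVn ler_pdivlMr; last by lra.
have := Lam_ge J; have := Lam_le J.
set p := (2 ^+ J)^-1; set L := limit_sum psi J; set T := chain_sum psi n.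
have p_gt0 : 0 < p by rewrite invr_gt0 exprn_gt0.
move=> Lam_hi Lam_lo p_small; rewrite !ler_norml => /andP[lo hi].
have n_ge0 : 0 <= n%:R :> R by [].
have e1 : n%:R * Lam <= n%:R * (L + B * p) by rewrite ler_wpM2l.
have e2 : n%:R * L <= n%:R * Lam by rewrite ler_wpM2l.
have e3 : n%:R * (p * (2 * B + 1)) <= n%:R * d by rewrite ler_wpM2l.
have e4 : 0 <= n%:R * p by rewrite mulr_ge0 // ltW.
by apply/andP; split; lra.
Qed.

Definition ln_fibo j : R := ln (fibo j.+1)%:R.

Lemma ln_fibo_steps : steps_in (ln 2) ln_fibo.
Proof.
move=> j; have fibo_pos k : 0 < (fibo k)%:R :> R by rewrite ltr0n fibo_gt0.
rewrite /ln_fibo subr_ge0 lerBlDr -lnM ?posrE ?ltr0n ?fibo_gt0 // -natrM.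
by rewrite !ler_ln ?posrE ?ltr0n ?muln_gt0 ?fibo_gt0 // !ler_nat fibo_leS fibo_double.
Qed.

Lemma ln_count_admissible n : 0 < (count_admissible n)%:R :> R /\
  ln (count_admissible n)%:R = chain_sum ln_fibo n.
Proof.
have ln_fibo0 : ln_fibo 0 = 0 by rewrite /ln_fibo (_ : fibo 1 = 1%N) // ln1.
rewrite count_admissibleE /chain_sum ln_fibo0.
under [in RHS]eq_bigr do rewrite subr0.
elim: (X in index_iota 1 X) => [|m [IH0 IH]]; first by rewrite !big_geq // ln1.
case: m IH0 IH => [|m] IH0 IH; first by rewrite !big_geq // ln1.
have rec (V : Type) (idx : V) (op : Monoid.law idx) (f : nat -> V) :
    \big[op/idx]_(1 <= i < m.+2 | odd i) f i =
    op (\big[op/idx]_(1 <= i < m.+1 | odd i) f i) (if odd m.+1 then f m.+1 else idx).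
  by rewrite big_mkcond big_nat_recr //= -big_mkcond.
rewrite !rec /= -IH; case: ifP => _; last by rewrite muln1 addr0.
have fibo_pos : 0 < (fibo (chain_length n m.+1).+1)%:R :> R by rewrite ltr0n fibo_gt0.
by rewrite natrM mulr_gt0 // lnM ?posrE.
Qed.

End Asymptotics.

(** * Covering numbers *)

Lemma sum_window (P : pred nat) k M :
  (forall x y, P x -> P y -> (x <= y + k)%N) ->
  (\sum_(0 <= N < M) P N <= k.+1)%N.
Proof.
move=> P_close; have [[x Px]|no_P] := pselect (exists x, P x); last first.
  by rewrite big1 // => N _; case: (boolP (P N)) => // PN; case: no_P; exists N.
case: (ex_minnP (ex_intro _ x Px)) => x0 Px0 x0_min.
have -> : (\sum_(0 <= N < M) P N = size [seq N <- iota 0 M | P N])%N.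
  by rewrite size_filter -sum1_count [RHS]big_mkcond /index_iota subn0.
rewrite -(size_iota x0 k.+1); apply: uniq_leq_size.
  by rewrite filter_uniq // iota_uniq.
move=> N; rewrite mem_filter => /andP[PN _]; rewrite mem_iota.
by apply/andP; split; [exact: x0_min | rewrite addnS ltnS; exact: P_close].
Qed.

Section BoxCounting.
Variable R : realType.

Lemma closed_ball_dist (c r x : R) : 0 < r -> closed_ball c r x = (`|c - x| <= r) :> Prop.
Proof. by move=> r_gt0; rewrite closed_ballE. Qed.

Lemma covering_number_le n (r : R) : (2 ^+ n)^-1 <= r ->
  (covering_number (@Xi_G R) r <= (count_admissible n)%:R%:E)%E.
Proof.
move=> le_r; have r_gt0 : 0 < r by apply: lt_le_trans le_r; rewrite invr_gt0 exprn_gt0.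
apply: ereal_inf_lbound; exists (count_admissible n) => //=.
pose L := [seq w <- words n | admissible w].
exists (fun i : 'I_(count_admissible n) => (binval (nth [::] L i))%:R / 2 ^+ n).
move=> x /Xi_G_golden[a a_golden x_a].
have in_L : initial a n \in L.
  by rewrite mem_filter admissible_initial // mem_words size_initial eqxx.
have lt_i : (index (initial a n) L < count_admissible n)%N by rewrite index_mem.
exists (Ordinal lt_i) => //=; rewrite closed_ball_dist // nth_index //.
have := x_a n; rewrite -(natr1 (binval _)) mulrDl mul1r => /andP[lo hi].
by apply: le_trans le_r; rewrite ler_norml; apply/andP; split; lra.
Qed.

(** Every admissible word of length [n] is the beginning of a point of the set, and
    a ball of radius at most [2^-n] contains such points for at most four words. *)
Lemma covering_number_ge n (r : R) : 0 < r <= (2 ^+ n)^-1 ->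
  (((count_admissible n)%:R / 4)%:E <= covering_number (@Xi_G R) r)%E.
Proof.
move=> /andP[r_gt0 le_r]; apply: le_ereal_inf_tmp => _ [m [c c_cover] <-].
rewrite lee_fin ler_pdivrMr // -natrM ler_nat.
have pow_gt0 : 0 < 2 ^+ n :> R by rewrite exprn_gt0.
pose near_ball (i : 'I_m) N := `[< exists x : R, `|c i - x| <= r /\
  N%:R / 2 ^+ n <= x <= N.+1%:R / 2 ^+ n >].
have near_close i x y : near_ball i x -> near_ball i y -> (x <= y + 3)%N.
  move=> /asboolP[z [z_ball /andP[z_lo _]]] /asboolP[z' [z'_ball /andP[_ z'_hi]]].
  have p_gt0 : 0 < (2 ^+ n)^-1 :> R by rewrite invr_gt0.
  rewrite -ltnS -(ltr_nat R) -(ltr_pM2r p_gt0).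
  have -> : (y + 3).+1%:R = y.+1%:R + 3 :> R by rewrite -natrD; congr (_%:R); lia.
  rewrite mulrDl; move: z_ball z'_ball; rewrite !ler_norml => /andP[? ?] /andP[? ?].
  lra.
have -> : count_admissible n = (\sum_(0 <= N < 2 ^ n) admissible (word n N))%N.
  rewrite /count_admissible size_filter -sum1_count big_mkcond /= /words big_map.
  by rewrite /index_iota subn0; apply: eq_bigr => N _; case: (admissible _).
apply: (@leq_trans (\sum_(0 <= N < 2 ^ n) \sum_(i < m) near_ball i N)%N).
  rewrite big_nat [leqRHS]big_nat; apply: leq_sum => N /andP[_ lt_N].
  case: (boolP (admissible (word n N))) => // admissible_w.
  have w_golden : golden (digit (word n N)).
    by apply: initial_admissible => k; exact: admissible_digit.
  have [x Xx x_w] := golden_Xi_G R w_golden.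
  have [i _] := c_cover x Xx; rewrite closed_ball_dist // => x_ball.
  rewrite (bigD1 i) //= (_ : near_ball i N) //.
  apply/asboolP; exists x; split=> //.
  have := x_w n; have := initial_digit (word n N).
  by rewrite size_word => ->; rewrite binval_word.
rewrite exchange_big /=; apply: (@leq_trans (\sum_(i < m) 4)%N).
  by apply: leq_sum => i _; apply: sum_window => x y; exact: near_close.
by rewrite sum_nat_const card_ord.
Qed.

(** For [2^-(n+1) < r <= 2^-n] the logarithm of the covering number is
    [n Lam + o(n)], while [ln (1/r) = n ln 2 + O(1)]. *)
Lemma minkowski_dim_Xi_G (Lam : R) :
  (forall d, 0 < d -> exists K, forall n,
     `|ln (count_admissible n)%:R - n%:R * Lam| <= d * n%:R + K) ->
  has_minkowski_dim (@Xi_G R) (Lam / ln 2)%:E.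
Proof.
move=> count_asymp; have ln2 := ln2_gt0 R.
pose f (r : R) := fine (covering_number (@Xi_G R) r).
have count_gt0 n : 0 < (count_admissible n)%:R :> R by have [] := ln_count_admissible R n.
have scale (r : R) : 0 < r < 1 -> exists n,
    [/\ n%:R <= ln r^-1 / ln 2 < n.+1%:R, covering_number (@Xi_G R) r = (f r)%:E
      & (count_admissible n)%:R / 4 <= f r <= (count_admissible n.+1)%:R].
  move=> /andP[r_gt0 root_lt1].
  have ln_r_ge0 : 0 <= ln r^-1 / ln 2.
    by rewrite divr_ge0 // ltW // ln_gt0 // invf_gt1.
  have /andP[n_le n_gt] := truncn_itv ln_r_ge0.
  set n := Num.trunc _ in n_le n_gt; exists n.
  have r_exp : r = expR (- ln r^-1) by rewrite lnV ?posrE // opprK lnK.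
  have r_le : r <= (2 ^+ n)^-1.
    by rewrite -expR_ln2 r_exp ler_expR lerN2 mulrC -ler_pdivlMr.
  have r_ge : (2 ^+ n.+1)^-1 <= r.
    by rewrite -expR_ln2 r_exp ler_expR lerN2 mulrC -ler_pdivrMr // ltW.
  have cov_le := covering_number_le r_ge.
  have r_range : 0 < r <= (2 ^+ n)^-1 by rewrite r_gt0.
  have cov_ge := covering_number_ge r_range.
  have cov_fin : covering_number (@Xi_G R) r = (f r)%:E.
    rewrite /f fineK // ge0_fin_numE ?(le_lt_trans cov_le) ?ltry //.
    by apply: le_trans cov_ge; rewrite lee_fin divr_ge0.
  by rewrite n_le n_gt -!lee_fin -cov_fin cov_le cov_ge.
have near01 : \forall r \near (0 : R)^'+, 0 < r < 1.
  near=> r; apply/andP; split; near: r; [exact: nbhs_right_gt | exact: nbhs_right_lt].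
have f_gt0 (r : R) : 0 < r < 1 -> 0 < f r.
  by move=> /scale[n [_ _ /andP[lo _]]]; apply: lt_le_trans lo; rewrite divr_gt0.
have quot (r : R) : 0 < r < 1 ->
    (lne (covering_number (@Xi_G R) r) / (ln r^-1)%:E)%E = (ln (f r) / ln r^-1)%:E.
  move=> r01; have [n [_ -> _]] := scale r r01; rewrite lne_EFin ?f_gt0 //.
  have ln_gt0' : 0 < ln r^-1 by case/andP: r01 => *; rewrite ln_gt0 // invf_gt1.
  by rewrite inver gt_eqF // EFinM.
apply/fine_cvgP; split.
  by near=> r; rewrite quot //; near: r.
apply/cvgrPdist_le => e e_gt0.
have d_gt0 : 0 < e * ln 2 / 2 by rewrite divr_gt0 // mulr_gt0.
have [K HK] := count_asymp _ d_gt0; set d := e * ln 2 / 2 in d_gt0 HK.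
(* Rounding to an integer level costs [d + `|Lam|], and the four words per ball
   cost [ln 4]. *)
pose K' := `|K| + d + `|Lam| + ln 4.
near=> r.
have r01 : 0 < r < 1 by near: r.
rewrite /= quot //=; have [n [/andP[n_le n_gt] _ /andP[f_lo f_hi]]] := scale r r01.
have ln_r_gt0 : 0 < ln r^-1 by case/andP: r01 => *; rewrite ln_gt0 // invf_gt1.
set x := ln r^-1 / ln 2 in n_le n_gt.
have ln_r : ln r^-1 = x * ln 2 by rewrite /x mulfVK // gt_eqF.
have f_pos := f_gt0 r r01.
have ln_lo : ln (count_admissible n)%:R - ln 4 <= ln (f r).
  by rewrite -ln_div ?posrE // ler_ln ?posrE // divr_gt0.
have ln_hi : ln (f r) <= ln (count_admissible n.+1)%:R by rewrite ler_ln ?posrE.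
have x_big : K' <= d * x.
  rewrite -ler_pdivrMl // /x ler_pdivlMr // lnV ?posrE; last by case/andP: r01.
  rewrite lerNr -ler_expR lnK ?posrE; last by case/andP: r01.
  apply: ltW; near: r; apply: nbhs_right_lt; exact: expR_gt0.
have := HK n; have := HK n.+1; rewrite -(natr1 n).
have n_gt' : x < n%:R + 1 by rewrite natr1.
have ln4 : 0 <= ln 4 :> R by rewrite ln_ge0 // ler1n.
have Lam_n : `|(x - n%:R) * Lam| <= `|Lam|.
  rewrite normrM ler_piMl // ger0_norm; lra.
have K_le := ler_norm K; have Lam_le := ler_norm Lam.
have Lam_ge : - `|Lam| <= Lam by rewrite lerNl -normrN ler_norm.
have dn_le : d * n%:R <= d * x by rewrite ler_pM2l.
have Lam_n1 : `|(n%:R + 1 - x) * Lam| <= `|Lam|.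
  rewrite normrM ler_piMl // ger0_norm; lra.
move: Lam_n Lam_n1; rewrite !ler_norml => /andP[? ?] /andP[? ?] /andP[? ?] /andP[? ?].
have final : `|x * Lam - ln (f r)| <= e * (x * ln 2).
  have -> : e * (x * ln 2) = 2 * (d * x) by rewrite /d; field.
  by rewrite ler_norml /K' in x_big *; apply/andP; split; lra.
rewrite ln_r; have -> : Lam / ln 2 - ln (f r) / (x * ln 2) =
    (x * Lam - ln (f r)) / (x * ln 2).
  by field; rewrite !gt_eqF //; rewrite /x divr_gt0.
have x_gt0 : 0 < x * ln 2 by rewrite -ln_r.
have : `|(x * Lam - ln (f r)) / (x * ln 2)| <= e.
  by rewrite normrM normfV (gtr0_norm x_gt0) ler_pdivrMr.
by rewrite ler_norml.
Unshelve. all: by end_near.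
Qed.

End BoxCounting.

(** * Numerical estimates *)

Section Numerics.
Variable R : realType.
Implicit Types p q r : R.

(** One step of binary exponentiation with rounding, in logarithmic form: [c] is an
    upper bound of [p^k 2^e], and the next bound is obtained by squaring, multiplying
    by [U^b], and rescaling by [2^j] to keep the number of digits constant. *)
Lemma ln_step_le (p U c c' k e k' e' : R) (b j : nat) :
  0 < p <= U -> 0 < c -> k * ln p + e * ln 2 <= ln c ->
  c * c * U ^+ b * 2 ^+ j <= c' -> k' = 2 * k + b%:R -> e' = 2 * e + j%:R ->
  k' * ln p + e' * ln 2 <= ln c'.
Proof.
move=> /andP[p_gt0 p_le] c_gt0 le_c le_c' -> ->.
have U_gt0 : 0 < U := lt_le_trans p_gt0 p_le.
have ln_p_le : ln p <= ln U by rewrite ler_ln ?posrE.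
have : ln (c * c * U ^+ b * 2 ^+ j) <= ln c'.
  by rewrite ler_ln ?posrE // ?(lt_le_trans _ le_c') // !mulr_gt0 ?exprn_gt0.
rewrite !lnM ?posrE ?mulr_gt0 ?exprn_gt0 // !lnXn // -(mulr_natl _ j) -(mulr_natl _ b) => le_ln.
have : b%:R * ln p <= b%:R * ln U by rewrite ler_wpM2l.
lra.
Qed.

Lemma ln_step_ge (p U c c' k e k' e' : R) (b j : nat) :
  0 < U <= p -> 0 < c' /\ 0 < c -> ln c <= k * ln p + e * ln 2 ->
  c' <= c * c * U ^+ b * 2 ^+ j -> k' = 2 * k + b%:R -> e' = 2 * e + j%:R ->
  ln c' <= k' * ln p + e' * ln 2.
Proof.
move=> /andP[U_gt0 p_ge] [c'_gt0 c_gt0] ge_c ge_c' -> ->.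
have ln_p_ge : ln U <= ln p by rewrite ler_ln ?posrE ?(lt_le_trans U_gt0).
have : ln c' <= ln (c * c * U ^+ b * 2 ^+ j).
  by rewrite ler_ln ?posrE // !mulr_gt0 ?exprn_gt0.
rewrite !lnM ?posrE ?mulr_gt0 ?exprn_gt0 // !lnXn // -(mulr_natl _ j) -(mulr_natl _ b) => le_ln.
have : b%:R * ln U <= b%:R * ln p by rewrite ler_wpM2l.
lra.
Qed.

Lemma cubic_unique p q : 0 < p < 1 -> p ^+ 3 = (1 - p) ^+ 2 ->
  0 < q < 1 -> q ^+ 3 = (1 - q) ^+ 2 -> q = p.
Proof.
have below (x y : R) : 0 < x < 1 -> 0 < y < 1 -> x ^+ 3 = (1 - x) ^+ 2 ->
    y ^+ 3 = (1 - y) ^+ 2 -> y <= x.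
  move=> /andP[x0 x1] /andP[y0 y1] ex ey; rewrite leNgt; apply/negP => lt_xy.
  have : x ^+ 3 < y ^+ 3 by rewrite ltr_pXn2r // nnegrE ltW.
  have : (1 - y) ^+ 2 < (1 - x) ^+ 2 by rewrite ltr_pXn2r ?nnegrE ?subr_ge0 ?ltW //; lra.
  by rewrite ex ey => /lt_trans lt1 /lt1; rewrite ltxx.
by move=> p01 ep q01 eq_; apply/eqP; rewrite eq_le !below.
Qed.

Lemma cubic_bounds p : 0 < p < 1 -> p ^+ 3 = (1 - p) ^+ 2 ->
  ((569 * 10 ^+ 6 + 840 * 10 ^+ 3 + 290) / 10 ^+ 9 : R) <= p <= ((569 * 10 ^+ 6 + 840 * 10 ^+ 3 + 292) / 10 ^+ 9).
Proof.
have below (x y : R) : 0 <= x -> x < y -> y <= 1 ->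
    x ^+ 3 < y ^+ 3 /\ (1 - y) ^+ 2 < (1 - x) ^+ 2.
  by move=> x0 lt_xy y1; split; rewrite ltr_pXn2r ?nnegrE //; lra.
move=> /andP[p0 p1] ep; apply/andP; split; rewrite leNgt; apply/negP => lt_p.
  have [] := below _ _ (ltW p0) lt_p; first by lra.
  by rewrite ep; lra.
have [] := below _ _ _ lt_p (ltW p1); first by lra.
by rewrite ep; lra.
Qed.

(** The fraction [2469/3043] is the simplest one in the interval from [0.81137] to
    [- log2 p], which is shorter than [5 10^-7]. *)
Lemma ln_root_le p : 0 < p <= ((569 * 10 ^+ 6 + 840 * 10 ^+ 3 + 292) / 10 ^+ 9) ->
  3043 * ln p + 2469 * ln 2 <= 0.
Proof.
move=> p_bound; have /andP[p_gt0 p_le] := p_bound.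
have s1 : 1 * ln p + 0 * ln 2 <=
    ln ((569 * 10 ^+ 6 + 840 * 10 ^+ 3 + 292) / 10 ^+ 9 : R).
  by rewrite mul1r mul0r addr0 ler_ln ?posrE; lra.
have s2 : 2 * ln p + 1 * ln 2 <=
    ln ((649 * 10 ^+ 6 + 435 * 10 ^+ 3 + 917) / 10 ^+ 9 : R).
  by apply: (ln_step_le (b := 0) (j := 1) p_bound _ s1); clear; lra.
have s5 : 5 * ln p + 4 * ln 2 <=
    ln ((961 * 10 ^+ 6 + 359 * 10 ^+ 3 + 346) / 10 ^+ 9 : R).
  by apply: (ln_step_le (b := 1) (j := 2) p_bound _ s2); clear; lra.
have s11 : 11 * ln p + 8 * ln 2 <=
    ln ((526 * 10 ^+ 6 + 653 * 10 ^+ 3 + 118) / 10 ^+ 9 : R).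
  by apply: (ln_step_le (b := 1) (j := 0) p_bound _ s5); clear; lra.
have s23 : 23 * ln p + 18 * ln 2 <=
    ln ((632 * 10 ^+ 6 + 211 * 10 ^+ 3 + 607) / 10 ^+ 9 : R).
  by apply: (ln_step_le (b := 1) (j := 2) p_bound _ s11); clear; lra.
have s47 : 47 * ln p + 38 * ln 2 <=
    ln ((911 * 10 ^+ 6 + 41 * 10 ^+ 3 + 321) / 10 ^+ 9 : R).
  by apply: (ln_step_le (b := 1) (j := 2) p_bound _ s23); clear; lra.
have s95 : 95 * ln p + 77 * ln 2 <=
    ln ((945 * 10 ^+ 6 + 930 * 10 ^+ 3 + 655) / 10 ^+ 9 : R).
  by apply: (ln_step_le (b := 1) (j := 1) p_bound _ s47); clear; lra.
have s190 : 190 * ln p + 154 * ln 2 <=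
    ln ((894 * 10 ^+ 6 + 784 * 10 ^+ 3 + 805) / 10 ^+ 9 : R).
  by apply: (ln_step_le (b := 0) (j := 0) p_bound _ s95); clear; lra.
have s380 : 380 * ln p + 308 * ln 2 <=
    ln ((800 * 10 ^+ 6 + 639 * 10 ^+ 3 + 848) / 10 ^+ 9 : R).
  by apply: (ln_step_le (b := 0) (j := 0) p_bound _ s190); clear; lra.
have s760 : 760 * ln p + 616 * ln 2 <=
    ln ((641 * 10 ^+ 6 + 24 * 10 ^+ 3 + 167) / 10 ^+ 9 : R).
  by apply: (ln_step_le (b := 0) (j := 0) p_bound _ s380); clear; lra.
have s1521 : 1521 * ln p + 1234 * ln 2 <=
    ln ((936 * 10 ^+ 6 + 616 * 10 ^+ 3 + 817) / 10 ^+ 9 : R).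
  by apply: (ln_step_le (b := 1) (j := 2) p_bound _ s760); clear; lra.
have s3043 : 3043 * ln p + 2469 * ln 2 <=
    ln ((999 * 10 ^+ 6 + 786 * 10 ^+ 3 + 3) / 10 ^+ 9 : R).
  by apply: (ln_step_le (b := 1) (j := 1) p_bound _ s1521); clear; lra.
by apply: le_trans s3043 _; apply: ln_le0; clear; lra.
Qed.

(** The fraction [271/334] lies between [- log2 p] and [0.81138]. *)
Lemma ln_root_gt p : ((569 * 10 ^+ 6 + 840 * 10 ^+ 3 + 290) / 10 ^+ 9) <= p ->
  0 < 334 * ln p + 271 * ln 2.
Proof.
move=> p_ge.
have p_bound : 0 < ((569 * 10 ^+ 6 + 840 * 10 ^+ 3 + 290) / 10 ^+ 9 : R) <= p.
  by rewrite p_ge andbT; clear; lra.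
have s1 : ln ((569 * 10 ^+ 6 + 840 * 10 ^+ 3 + 290) / 10 ^+ 9 : R)
    <= 1 * ln p + 0 * ln 2.
  by rewrite mul1r mul0r addr0 ler_ln ?posrE; lra.
have s2 : ln ((649 * 10 ^+ 6 + 435 * 10 ^+ 3 + 912) / 10 ^+ 9 : R)
    <= 2 * ln p + 1 * ln 2.
  by apply: (ln_step_ge (b := 0) (j := 1) p_bound _ s1); clear; lra.
have s5 : ln ((961 * 10 ^+ 6 + 359 * 10 ^+ 3 + 327) / 10 ^+ 9 : R)
    <= 5 * ln p + 4 * ln 2.
  by apply: (ln_step_ge (b := 1) (j := 2) p_bound _ s2); clear; lra.
have s10 : ln ((924 * 10 ^+ 6 + 211 * 10 ^+ 3 + 755) / 10 ^+ 9 : R)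
    <= 10 * ln p + 8 * ln 2.
  by apply: (ln_step_ge (b := 0) (j := 0) p_bound _ s5); clear; lra.
have s20 : ln ((854 * 10 ^+ 6 + 167 * 10 ^+ 3 + 368) / 10 ^+ 9 : R)
    <= 20 * ln p + 16 * ln 2.
  by apply: (ln_step_ge (b := 0) (j := 0) p_bound _ s10); clear; lra.
have s41 : ln ((831 * 10 ^+ 6 + 513 * 10 ^+ 3 + 108) / 10 ^+ 9 : R)
    <= 41 * ln p + 33 * ln 2.
  by apply: (ln_step_ge (b := 1) (j := 1) p_bound _ s20); clear; lra.
have s83 : ln ((787 * 10 ^+ 6 + 991 * 10 ^+ 3 + 164) / 10 ^+ 9 : R)
    <= 83 * ln p + 67 * ln 2.
  by apply: (ln_step_ge (b := 1) (j := 1) p_bound _ s41); clear; lra.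
have s167 : ln ((707 * 10 ^+ 6 + 661 * 10 ^+ 3 + 947) / 10 ^+ 9 : R)
    <= 167 * ln p + 135 * ln 2.
  by apply: (ln_step_ge (b := 1) (j := 1) p_bound _ s83); clear; lra.
have s334 : ln ((500 * 10 ^+ 6 + 785 * 10 ^+ 3 + 431) / 10 ^+ 9 : R)
    <= 334 * ln p + 270 * ln 2.
  by apply: (ln_step_ge (b := 0) (j := 0) p_bound _ s167); clear; lra.
have half_lt : ln (1 / 2 : R) <
    ln ((500 * 10 ^+ 6 + 785 * 10 ^+ 3 + 431) / 10 ^+ 9 : R).
  by rewrite ltr_ln ?posrE; clear; lra.
have ln_half : ln (1 / 2 : R) = - ln 2 by rewrite div1r lnV ?posrE.
have := lt_le_trans half_lt s334; rewrite ln_half; clear; lra.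
Qed.

Lemma log2_root_bounds p : 0 < p < 1 -> p ^+ 3 = (1 - p) ^+ 2 ->
  (811 * 10 ^+ 2 + 37) / 10 ^+ 5 <= - log2 p < (811 * 10 ^+ 2 + 38) / 10 ^+ 5.
Proof.
move=> p01 ep; have /andP[p_ge p_le] := cubic_bounds p01 ep.
have ln2 := ln2_gt0 R; have p_gt0 : 0 < p by case/andP: p01.
have p_bound : 0 < p <= ((569 * 10 ^+ 6 + 840 * 10 ^+ 3 + 292) / 10 ^+ 9) by rewrite p_gt0.
have := ln_root_le p_bound; have := ln_root_gt p_ge.
rewrite /log2 -mulNr ler_pdivlMr // ltr_pdivrMr // => lo hi.
by clear p_ge p_le p_bound; apply/andP; split; lra.
Qed.

(** Multiplied by 64, this says that [2^52] is less than
    [2^32 (3/2)^16 (5/3)^8 (8/5)^4 (13/8)^2 (21/13)]. *)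
Lemma limit_sum_ln_fibo : 52 / 64 * ln 2 < limit_sum (ln_fibo R) 6.
Proof.
have pos (k : nat) : (k.+1%:R : R) \is Num.pos by rewrite posrE ltr0n.
have ln_pow (k j : nat) : ln ((k.+1%:R : R) ^+ j) = j%:R * ln k.+1%:R.
  by rewrite lnXn -?posrE // mulr_natl.
have powers : 36 * ln 2 < 8 * ln 3 + 4 * ln 5 + 2 * ln 8 + ln 13 + ln 21 :> R.
  have : ln (2 ^+ 36 : R) < ln (3 ^+ 8 * 5 ^+ 4 * 8 ^+ 2 * 13 * 21).
    by rewrite ltr_ln ?posrE; lra.
  by rewrite (ln_pow 1 36) 4?lnM ?rpredM ?rpredX ?pos // (ln_pow 2 8) (ln_pow 4 4) (ln_pow 7 2).
rewrite /limit_sum !big_nat_recr //= big_geq // /ln_fibo.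
have -> : fibo 1 = 1%N by [].
have -> : fibo 2 = 2%N by [].
have -> : fibo 3 = 3%N by [].
have -> : fibo 4 = 5%N by [].
have -> : fibo 5 = 8%N by [].
have -> : fibo 6 = 13%N by [].
have -> : fibo 7 = 21%N by [].
rewrite ln1; lra.
Qed.

Lemma root_exists : exists2 r : R, 0 < r & r ^+ 2 + r ^+ 3 = 1.
Proof.
pose P : {poly R} := 'X^2 + 'X^3 - 1.
have P_sign : P.[0] <= 0 <= P.[1] by rewrite /P !hornerE; lra.
have [r /andP[r_ge0 _] /eqP] := poly_ivt ler01 P_sign.
rewrite /P !hornerE => Pr; exists r; last by lra.
rewrite lt0r r_ge0 andbT; apply/eqP => r0; move: Pr; rewrite r0; lra.
Qed.

End Numerics.

Theorem theorem1p1 (R : realType) :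
  (exists2 m : R, has_minkowski_dim (@Xi_G R) m%:E
                & (hausdorff_dim (@Xi_G R) < m%:E)%E) /\
  exists p : R,
    [/\ forall q : R, (0 < q < 1 /\ q ^+ 3 = (1 - q) ^+ 2) <-> q = p,
        hausdorff_dim (@Xi_G R) = (- log2 p)%:E
      & (811 * 10 ^+ 2 + 37) / 10 ^+ 5 <= - log2 p < (811 * 10 ^+ 2 + 38) / 10 ^+ 5].
Proof.
have [r r_gt0 r_root] := root_exists R.
have ln2 := ln2_gt0 R.
pose p := r ^+ 2.
have p01 : 0 < p < 1.
  by rewrite exprn_gt0 //= exprn_ilt1 ?(ltW r_gt0) // (root_lt1 r_root).
have ep : p ^+ 3 = (1 - p) ^+ 2.
  have -> : 1 - p = r ^+ 3 by rewrite /p -r_root; ring.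
  by rewrite /p -!exprM.
have dim_p : hausdorff_dim (@Xi_G R) = (- log2 p)%:E.
  rewrite (hausdorff_dim_Xi_G r_gt0 r_root) /log2 /p lnXn //.
  by congr (_%:E); ring.
have bounds := log2_root_bounds p01 ep.
split; last first.
  exists p; split=> // q; split=> [[q01 eq_]|->]; last by split.
  exact: cubic_unique p01 ep q01 eq_.
have [Lam Lam_ge Lam_asymp] := chain_sum_asymp (@ln_fibo_steps R).
exists (Lam / ln 2).
  apply: minkowski_dim_Xi_G => d /Lam_asymp[K HK].
  by exists K => n; have [_ ->] := ln_count_admissible R n.
(* [- log2 p < 0.81138 < 52 / 64 < Lam / ln 2] *)
rewrite dim_p lte_fin; case/andP: bounds => _ /lt_le_trans; apply.
rewrite ler_pdivlMr //; have := Lam_ge 6; have := limit_sum_ln_fibo R; lra.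
Qed.
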